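(* Let $0.85798\leq\omega\leq1$. For every two-qubit (in general mixed) state $\rho_{AB}$, $$\mathfrak{C}_\omega(\rho_{AB})=h_\omega[C(\rho_{AB})],$$ where $\mathfrak{C}_\omega$ is the $G_\omega$-concurrence, $C$ is the concurrence, and $$h_\omega(\theta)=\Big[\Big(\tfrac{1+\sqrt{1-\theta^2}}{2}\Big)^\omega+\Big(\tfrac{1-\sqrt{1-\theta^2}}{2}\Big)^\omega-1\Big]^\omega,\qquad 0\leq\theta\leq1.$$
   Context: For $0<\omega\leq1$ the $G_\omega$-concurrence of a bipartite pure state $|\varphi\rangle_{AB}$ is $\mathfrak{C}_\omega(|\varphi\rangle_{AB})=[\mathrm{tr}(\rho_A^\omega)-1]^\omega$ with $\rho_A=\mathrm{tr}_B(|\varphi\rangle_{AB}\langle\varphi|)$ (with $0^\omega=0$ on the kernel of $\rho_A$). For a mixed state, $\mathfrak{C}_\omega(\rho_{AB})=\min\sum_i p_i\,\mathfrak{C}_\omega(|\varphi_i\rangle)$, the minimum being over all pure state decompositions $\rho_{AB}=\sum_i p_i|\varphi_i\rangle\langle\varphi_i|$. The concurrence of a pure state is $C(|\varphi\rangle_{AB})=\sqrt{2(1-\mathrm{tr}\rho_A^2)}$ (for a two-qubit pure state with squared Schmidt coefficients $\chi_1,\chi_2$ this equals $2\sqrt{\chi_1\chi_2}$), and for a mixed state $C(\rho_{AB})=\min\sum_i p_i\,C(|\varphi_i\rangle)$ over all pure state decompositions. *)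

(* Defs.v *)
From HB Require Import structures.
From mathcomp Require Import all_boot all_order all_algebra.
From mathcomp Require Import all_classical all_reals all_analysis.
From mathcomp Require Import spectral complex.

Set Implicit Arguments.
Unset Strict Implicit.
Unset Printing Implicit Defensive.

Import Order.TTheory GRing.Theory Num.Theory.

Local Open Scope classical_set_scope.
Local Open Scope complex_scope.
Local Open Scope sesquilinear_scope.
Local Open Scope ring_scope.

(* The space C^m (x) C^n is 'cV[R[i]]_(m * n); the product basis vector
   |i>|j> is the one of index mxvec_index i j. *)

Definition pure_state (R : realType) d (phi : 'cV[R[i]]_d) : Prop :=
  phi ^t* *m phi = 1%:M.

(* |phi><phi| *)
Definition projector (R : realType) d (phi : 'cV[R[i]]_d) : 'M[R[i]]_d :=
  phi *m phi ^t*.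

(* In R[i], [0 <= z] says that z is real and nonnegative. *)
Definition density_matrix (R : realType) d (rho : 'M[R[i]]_d) : Prop :=
  [/\ rho \is hermsymmx,
      forall v : 'cV[R[i]]_d, 0 <= (v ^t* *m rho *m v) 0 0
    & \tr rho = 1].

Definition ptraceB (R : realType) m n (rho : 'M[R[i]]_(m * n)) : 'M[R[i]]_m :=
  \matrix_(i, i') \sum_(j < n) rho (mxvec_index i j) (mxvec_index i' j).

Definition reduced_state (R : realType) m n (phi : 'cV[R[i]]_(m * n)) :
    'M[R[i]]_m :=
  ptraceB (projector phi).

(* Real power of a positive semidefinite matrix by functional calculus, from
   A = U^-1 *m diag_mx (spectral_diag A) *m U with U = spectralmx A unitary.
   For s != 0, 0 `^ s = 0, so the kernel of A is mapped to 0. *)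
Definition mxpowR (R : realType) d (A : 'M[R[i]]_d) (s : R) : 'M[R[i]]_d :=
  invmx (spectralmx A)
    *m diag_mx (map_mx (fun z : R[i] => (complex.Re z `^ s)%:C)
                       (spectral_diag A))
    *m spectralmx A.

Definition pure_Gconcurrence (R : realType) m n (omega : R)
    (phi : 'cV[R[i]]_(m * n)) : R :=
  (complex.Re (\tr (mxpowR (reduced_state phi) omega)) - 1) `^ omega.

Definition pure_concurrence (R : realType) m n (phi : 'cV[R[i]]_(m * n)) : R :=
  Num.sqrt
    (2 * (1 - complex.Re (\tr (reduced_state phi *m reduced_state phi)))).

Definition pure_decomposition (R : realType) d (rho : 'M[R[i]]_d) k
    (p : 'I_k -> R) (phi : 'I_k -> 'cV[R[i]]_d) : Prop :=
  [/\ forall i, 0 <= p i,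
      \sum_(i < k) p i = 1,
      forall i, pure_state (phi i)
    & rho = \sum_(i < k) (p i)%:C *: projector (phi i)].

(* Least element of S.  The default value, used only when S has no least
   element, is negative, hence not a value that a concurrence can take. *)
Definition minimum (R : realType) (S : set R) : R :=
  xget (-1) [set x | S x /\ lbound S x].

Definition decomposition_averages (R : realType) d (f : 'cV[R[i]]_d -> R)
    (rho : 'M[R[i]]_d) : set R :=
  [set x | exists k (p : 'I_k -> R) (phi : 'I_k -> 'cV[R[i]]_d),
     pure_decomposition rho p phi /\ x = \sum_(i < k) p i * f (phi i)].

Definition convex_roof (R : realType) d (f : 'cV[R[i]]_d -> R)
    (rho : 'M[R[i]]_d) : R :=
  minimum (decomposition_averages f rho).

Definition Gconcurrence (R : realType) m n (omega : R)
    (rho : 'M[R[i]]_(m * n)) : R :=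
  convex_roof (@pure_Gconcurrence R m n omega) rho.

Definition concurrence (R : realType) m n (rho : 'M[R[i]]_(m * n)) : R :=
  convex_roof (@pure_concurrence R m n) rho.

Definition h_fun (R : realType) (omega theta : R) : R :=
  (((1 + Num.sqrt (1 - theta ^+ 2)) / 2) `^ omega
     + ((1 - Num.sqrt (1 - theta ^+ 2)) / 2) `^ omega - 1) `^ omega.

(* Main.v *)
Require Import Defs.
From HB Require Import structures.
From mathcomp Require Import all_boot all_order all_algebra.
From mathcomp Require Import all_classical all_reals all_analysis.
From mathcomp Require Import spectral complex.
From mathcomp Require Import ring lra.

(* By Wootters' argument there is, for every two-qubit state, an optimal
   decomposition all of whose members have the same concurrence c: a Takagi
   factorization provides vectors v_j with rho = sum v_j v_j^* and
   v_i^T S v_j = l_j delta_ij, where S represents the spin flip.  Writing any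
   other decomposition in terms of the v_j bounds the average concurrence from
   below by c = max(0, 2 max_j l_j - sum_j l_j).  If c > 0, multiplying all v_j
   but one by i and mixing by a real orthogonal matrix that makes a traceless
   real form have zero diagonal attains c; if c = 0, phases closing the polygon
   with sides l_j, followed by a Hadamard mixing, do.

   The theorem then follows from Jensen's inequality, because a pure state has
   G_omega-concurrence h_omega of its concurrence and h_omega is increasing and
   convex.  For convexity put theta = 1 / cosh t, omega = 1 - e and
   u = tanh^2 t, and let g = h_omega^(1/omega), p = - g'(u) / A with
   A = - g'(u = 0).  Convexity amounts to
     g * (p - 2 (1 - u) p'(u)) >= 2 e A (1 - u) p^2.
   Here (1 - u) p' is nondecreasing in u and (1 - u)^(3/2 - e) p' is
   nonincreasing; this yields the lower bounds
     g >= (1 - u) (g(0) + A (p - 1))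
   and
     p - 2 (1 - u) p' >= (1 - 3 e - e^2) / 3 + 2 e (p - 1),
   whose product dominates the right-hand side for all u as soon as it does so
   at u = 0, that is at theta = 1.  The latter is what limits omega. *)

Set Implicit Arguments.
Unset Strict Implicit.
Unset Printing Implicit Defensive.

Import Order.TTheory GRing.Theory Num.Theory.
Import numFieldNormedType.Exports.

Local Open Scope classical_set_scope.
Local Open Scope complex_scope.
Local Open Scope sesquilinear_scope.
Local Open Scope ring_scope.

(** * Differentiation rules and hyperbolic functions *)

Section DerivativeRules.
Context {R : realType}.
Implicit Types (f g : R -> R) (x a k : R).

(* Locked, so that unification never triggers the type class search attached
   to is_derive. *)
Definition has_deriv f x df : Prop := locked (is_derive x (1 : R) f df).

Lemma has_derivE f x df : has_deriv f x df = is_derive x (1 : R) f df.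
Proof. by rewrite /has_deriv -lock. Qed.

Lemma has_deriv_eq f x df dg : has_deriv f x df -> df = dg -> has_deriv f x dg.
Proof. by move=> + <-. Qed.

Lemma deriv_cst k x : has_deriv (fun=> k) x 0.
Proof. by rewrite has_derivE; exact: is_derive_cst. Qed.

Lemma deriv_id x : has_deriv (fun y : R => y) x 1.
Proof. by rewrite has_derivE; exact: is_derive_id. Qed.

Lemma deriv_add f g x df dg : has_deriv f x df -> has_deriv g x dg ->
  has_deriv (fun y => f y + g y) x (df + dg).
Proof. by rewrite !has_derivE => Hf Hg; exact: is_deriveD. Qed.

Lemma deriv_opp f x df : has_deriv f x df ->
  has_deriv (fun y => - f y) x (- df).
Proof. by rewrite !has_derivE => Hf; exact: is_deriveN. Qed.

Lemma deriv_mul f g x df dg : has_deriv f x df -> has_deriv g x dg ->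
  has_deriv (fun y => f y * g y) x (df * g x + f x * dg).
Proof.
rewrite !has_derivE => Hf Hg; apply: (is_derive_eq (is_deriveM Hf Hg)).
by rewrite addrC [f x *: _]/GRing.scale /= [g x *: _]/GRing.scale /= [g x *
  _]mulrC.
Qed.

Lemma deriv_exp f n x df : has_deriv f x df ->
  has_deriv (fun y => f y ^+ n) x (n%:R * f x ^+ n.-1 * df).
Proof.
rewrite !has_derivE => Hf; have -> : (fun y => f y ^+ n) = f ^+ n;
  last exact: is_deriveX.
by apply/funext => y; elim: n => [|n IHn]; rewrite ?expr0 // !exprS IHn.
Qed.

Lemma deriv_inv f x df : f x != 0 -> has_deriv f x df ->
  has_deriv (fun y => (f y)^-1) x (- df / f x ^+ 2).
Proof.
rewrite !has_derivE => fx0 Hf; apply: (is_derive_eq (is_deriveV fx0 Hf)).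
by rewrite [LHS]/GRing.scale /= mulrC mulrN mulNr.
Qed.

Lemma deriv_comp f g x df dg : has_deriv f (g x) df ->
  has_deriv g x dg -> has_deriv (fun y => f (g y)) x (df * dg).
Proof.
by rewrite !has_derivE => Hf Hg; exact: (is_derive1_comp Hf Hg).
Qed.

Lemma deriv_expR f x df : has_deriv f x df ->
  has_deriv (fun y => expR (f y)) x (expR (f x) * df).
Proof. by apply: (@deriv_comp (@expR R)); rewrite has_derivE;
  exact: is_derive_expR. Qed.

Lemma deriv_powR f a x df : 0 < f x -> has_deriv f x df ->
  has_deriv (fun y => f y `^ a) x (a * f x `^ a * df / f x).
Proof.
move=> fx0 Hf; have H := is_derive1_powR a fx0; rewrite -has_derivE in H.
apply: (has_deriv_eq (@deriv_comp (fun y => y `^ a) f _ _ _ H Hf)).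
by rewrite powRB ?(gt_eqF fx0) ?implybT // powRr1 ?ltW //; field;
  rewrite gt_eqF.
Qed.

Lemma deriv_ln f x df : 0 < f x -> has_deriv f x df ->
  has_deriv (fun y => ln (f y)) x (df / f x).
Proof.
move=> fx0 Hf; have H := is_derive1_ln fx0; rewrite -has_derivE in H.
apply: (has_deriv_eq (@deriv_comp (@ln R) f _ _ _ H Hf)).
by rewrite mulrC.
Qed.

(** By the mean value theorem. The sign of [df] is required only in the open interval, since several
    formulas for derivatives below degenerate at 0. *)
Lemma nondecreasing_deriv f (df : R -> R) a b : a <= b ->
  (forall x, a <= x <= b -> has_deriv f x (df x)) ->
  (forall x, a < x < b -> 0 <= df x) -> f a <= f b.
Proof.
rewrite le_eqVlt => /orP[/eqP -> //|ab] Hd Hp.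
have [||c] := @MVT R f df a b ab.
- by move=> x; rewrite in_itv /= => /andP[h1 h2]; rewrite -has_derivE;
  apply: Hd; rewrite !ltW.
- apply: continuous_in_subspaceT => x; rewrite inE /= in_itv /= => hx.
  have := Hd x hx; rewrite has_derivE => -[h _];
    exact/differentiable_continuous/derivable1_diffP.
rewrite in_itv /= => hc Heq; rewrite -subr_ge0 Heq mulr_ge0 ?Hp // subr_ge0 ltW
  //.
Qed.

Lemma nonincreasing_deriv f (df : R -> R) a b : a <= b ->
  (forall x, a <= x <= b -> has_deriv f x (df x)) ->
  (forall x, a < x < b -> df x <= 0) -> f b <= f a.
Proof.
move=> ab Hd Hp; rewrite -lerN2.
apply: (@nondecreasing_deriv (fun x => - f x) (fun x => - df x)) => //.
- by move=> x /Hd; exact: deriv_opp.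
- by move=> x /Hp; rewrite oppr_ge0.
Qed.

End DerivativeRules.

Ltac deriv_step := first
  [ eapply deriv_add | eapply deriv_mul | eapply deriv_opp
  | eapply deriv_exp | eapply deriv_expR | eapply deriv_cst | eapply deriv_id ].
Ltac deriv := eapply has_deriv_eq;
  [repeat (solve [eauto with deriv] || deriv_step) | cbv beta].

(** Locked, so that unification does not unfold the hyperbolic functions into exponentials. *)
HB.lock Definition sinh {R : realType} (x : R) : R := (expR x - expR (- x)) / 2.
HB.lock Definition cosh {R : realType} (x : R) : R := (expR x + expR (- x)) / 2.

Section Hyperbolic.
Context {R : realType}.
Implicit Types (x y a b k : R).

Lemma sinhE x : sinh x = (expR x - expR (- x)) / 2.
Proof. by rewrite sinh.unlock. Qed.

Lemma coshE x : cosh x = (expR x + expR (- x)) / 2.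
Proof. by rewrite cosh.unlock. Qed.

Lemma sinhD x y : sinh (x + y) = sinh x * cosh y + cosh x * sinh y.
Proof. by rewrite !sinhE !coshE opprD !expRD; field. Qed.

Lemma coshD x y : cosh (x + y) = cosh x * cosh y + sinh x * sinh y.
Proof. by rewrite !sinhE !coshE opprD !expRD; field. Qed.

Lemma sinhN x : sinh (- x) = - sinh x.
Proof. by rewrite !sinhE opprK; field. Qed.

Lemma coshN x : cosh (- x) = cosh x.
Proof. by rewrite !coshE opprK; field. Qed.

Lemma sinh0 : sinh 0 = 0 :> R.
Proof. by rewrite !sinhE oppr0 subrr mul0r. Qed.

Lemma cosh0 : cosh 0 = 1 :> R.
Proof. by rewrite !coshE oppr0 expR0; field. Qed.

Lemma cosh_sqr x : cosh x ^+ 2 = 1 + sinh x ^+ 2.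
Proof.
have h : expR x * expR (- x) = 1 by rewrite -expRD subrr expR0.
have -> : 1 + sinh x ^+ 2 = expR x * expR (- x) + sinh x ^+ 2 by rewrite h.
by rewrite !sinhE !coshE; field.
Qed.

Lemma cosh_ge1 x : 1 <= cosh x.
Proof.
have c0 : 0 <= cosh x by rewrite coshE divr_ge0 // addr_ge0 // expR_ge0.
by rewrite -(@ler_pXn2r _ 2) ?nnegrE // expr1n cosh_sqr lerDl sqr_ge0.
Qed.

Lemma cosh_gt0 x : 0 < cosh x.
Proof. exact: lt_le_trans (cosh_ge1 x). Qed.

Lemma deriv_sinh k x : has_deriv (fun y => sinh (k * y)) x (k * cosh (k * x)).
Proof.
have -> : (fun y => sinh (k * y)) = fun y =>
  (expR (k * y) - expR (- (k * y))) / 2.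
  by apply/funext => y; rewrite sinhE.
by rewrite coshE; deriv; field.
Qed.

Lemma deriv_cosh k x : has_deriv (fun y => cosh (k * y)) x (k * sinh (k * x)).
Proof.
have -> : (fun y => cosh (k * y)) = fun y =>
  (expR (k * y) + expR (- (k * y))) / 2.
  by apply/funext => y; rewrite coshE.
by rewrite sinhE; deriv; field.
Qed.

Lemma deriv_sinh1 x : has_deriv (fun y => sinh y) x (cosh x).
Proof.
have -> : (fun y => sinh y) = fun y => sinh (1 * y) by apply/funext => y;
  rewrite mul1r.
by apply: has_deriv_eq (deriv_sinh 1 x) _; rewrite !mul1r.
Qed.

Lemma deriv_cosh1 x : has_deriv (fun y => cosh y) x (sinh x).
Proof.
have -> : (fun y => cosh y) = fun y => cosh (1 * y) by apply/funext => y;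
  rewrite mul1r.
by apply: has_deriv_eq (deriv_cosh 1 x) _; rewrite !mul1r.
Qed.

End Hyperbolic.
#[global] Hint Resolve deriv_sinh deriv_cosh deriv_sinh1 deriv_cosh1 : deriv.

Section HyperbolicInequalities.
Context {R : realType}.
Implicit Types (x y t a b d : R).

Lemma sinh_ge0 x : 0 <= x -> 0 <= sinh x.
Proof.
move=> x0; rewrite -(@sinh0 R);
  apply: (@nondecreasing_deriv _ _ cosh) => // y _.
- exact: deriv_sinh1.
- exact/ltW/cosh_gt0.
Qed.

Lemma cosh_le x y : 0 <= x -> x <= y -> cosh x <= cosh y.
Proof.
move=> x0 xy; apply: (@nondecreasing_deriv _ _ sinh) => // z /andP[hz _].
- exact: deriv_cosh1.
- by apply: sinh_ge0; exact: le_trans (ltW hz).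
Qed.

Lemma sinh_ge x : 0 <= x -> x <= sinh x.
Proof.
move=> x0; rewrite -subr_ge0; have -> : 0 = sinh 0 - 0 :> R by rewrite sinh0;
  ring.
apply: (@nondecreasing_deriv _ (fun y => sinh y - y) (fun y => cosh y - 1)) =>
  // y _.
- by deriv.
- by rewrite subr_ge0 cosh_ge1.
Qed.

Lemma sinh_gt0 x : 0 < x -> 0 < sinh x.
Proof. by move=> x0; rewrite (lt_le_trans x0) // sinh_ge ?ltW. Qed.

Lemma sinh_le_cosh x : 0 <= x -> sinh x <= x * cosh x.
Proof.
move=> x0; rewrite -subr_ge0.
have -> : 0 = 0 * cosh 0 - sinh 0 :> R by rewrite sinh0; ring.
apply: (@nondecreasing_deriv _ (fun y => y * cosh y - sinh y) (fun y =>
  y * sinh y)) => // y /andP[hy _].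
- by deriv; ring.
- by rewrite mulr_ge0 ?sinh_ge0 // ltW.
Qed.

Lemma sinh_scale a b t : 0 <= a -> a <= b -> 0 <= t ->
  b * sinh (a * t) <= a * sinh (b * t).
Proof.
move=> a0 ab t0; rewrite -subr_ge0.
have -> : 0 = a * sinh (b * 0) - b * sinh (a * 0) by rewrite !mulr0 sinh0; ring.
apply: (@nondecreasing_deriv _ (fun y => a * sinh (b * y) - b * sinh (a * y))
  (fun y => a * b * (cosh (b * y) - cosh (a * y)))) => // y /andP[hy _].
- by deriv; ring.
- have y0 := ltW hy; apply: mulr_ge0;
  first by rewrite mulr_ge0 // (le_trans a0).
  by rewrite subr_ge0 cosh_le ?mulr_ge0 // ler_wpM2r.
Qed.

(** In the derivative of the difference the products of two [cosh] cancel. The inequality amounts to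
    tanh (d t) <= d tanh t. *)
Lemma tanh_scale d t : 1 <= d -> 0 <= t ->
  sinh (d * t) * cosh t <= d * cosh (d * t) * sinh t.
Proof.
move=> d1 t0; rewrite -subr_ge0.
have -> : 0 = d * cosh (d * 0) * sinh 0 - sinh (d * 0) * cosh 0.
  by rewrite !mulr0 sinh0; ring.
apply: (@nondecreasing_deriv _
  (fun y => d * cosh (d * y) * sinh y - sinh (d * y) * cosh y)
  (fun y => (d ^+ 2 - 1) * (sinh (d * y) * sinh y))) => // y /andP[hy _].
- by deriv; ring.
- have y0 := ltW hy; have d0 : 0 <= d by lra.
  apply: mulr_ge0; first nra.
  by apply: mulr_ge0; apply: sinh_ge0 => //; exact: mulr_ge0.
Qed.

End HyperbolicInequalities.

(** * Convexity of h_omega *)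

Section SlopeInequalities.
Context {R : realType}.
Implicit Types e k t : R.

(** The numerator that arises when [pfun], defined later, is differentiated. In this form its
    derivative is a single product. *)
Definition wnum e t := (e * sinh ((2 + e) * t) - (2 + e) * sinh (e * t)) / 2.

Lemma deriv_wnum e t :
  has_deriv (wnum e) t (e * (2 + e) * (sinh ((1 + e) * t) * sinh t)).
Proof.
rewrite /wnum; deriv.
have -> : (2 + e) * t = (1 + e) * t + t by ring.
have -> : e * t = (1 + e) * t - t by ring.
by rewrite !coshD sinhN coshN; field.
Qed.

Lemma wnum0 e  : wnum e 0 = 0.
Proof. by rewrite /wnum !mulr0 sinh0; ring. Qed.

(* The comparisons of wnum with psi below express that [wfun e], defined later,
   is nondecreasing and that [cosh t `^ (2 * e - 1) * wfun e t] is
   nonincreasing. *)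
Definition psi e k t := sinh ((1 + e) * t) * (sinh t ^+ 2 * cosh t) / (3 + k *
  sinh t ^+ 2).

Definition dpsi e k t := sinh t * ((1 + e) * (3 + k * sinh t ^+ 2) * (sinh t *
  cosh t * cosh ((1 + e) * t))
     + sinh ((1 + e) * t) * ((2 + 3 * sinh t ^+ 2) * (3 + k * sinh t ^+ 2)
        - 2 * k * sinh t ^+ 2 * (1 + sinh t ^+ 2))) / (3 + k * sinh t ^+ 2) ^+
          2.

Lemma psi_den_gt0 k t : 0 <= k -> 0 < 3 + k * sinh t ^+ 2.
Proof. by move=> k0; rewrite ltr_pwDl // mulr_ge0 // sqr_ge0. Qed.

Lemma deriv_psi e k t : 0 <= k -> has_deriv (psi e k) t (dpsi e k t).
Proof.
move=> k0; have q0 := lt0r_neq0 (psi_den_gt0 t k0).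
rewrite /psi /dpsi; eapply has_deriv_eq.
  apply: deriv_mul; last apply: deriv_inv => //.
    by repeat (solve [eauto with deriv] || deriv_step).
  by repeat (solve [eauto with deriv] || deriv_step).
cbv beta.
rewrite /=; set S := sinh t; set K := cosh t; set X := sinh ((1 + e) * t);
  set Y := cosh ((1 + e) * t).
have K2 : K ^+ 2 = 1 + S ^+ 2 := cosh_sqr t.
have q1 : 3 + k * S ^+ 2 != 0 := q0.
apply: (mulIf (expf_neq0 2 q1)); rewrite divfK ?expf_neq0 //.
transitivity ((1 + e) * (3 + k * S ^+ 2) * (S * S * K * Y) + X * ((2 * S * K ^+
  2 + S ^+ 3) * (3 + k * S ^+ 2) - 2 * k * S ^+ 3 * K ^+ 2)); first by field.
by rewrite K2; ring.
Qed.

Lemma psi0 e k : psi e k 0 = 0.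
Proof. by rewrite /psi !mulr0 sinh0; ring. Qed.

(** Both sides vanish at 0, so derivatives are compared. [tanh_scale] bounds cosh ((1 + e) t) from
    below by a multiple of sinh ((1 + e) t); this factor cancels and a polynomial inequality in
    [sinh t ^+ 2] remains. *)
Lemma wnum_le_psi e t : 0 < e -> e <= 1 / 7 -> 0 <= t ->
  wnum e t <= e * (2 + e) * psi e (2 - e) t.
Proof.
move=> e_gt0 e_le t0; have e0 := ltW e_gt0; rewrite -subr_ge0.
have -> : 0 = e * (2 + e) * psi e (2 - e) 0 - wnum e 0 by rewrite psi0 wnum0;
  ring.
have k0 : 0 <= 2 - e by lra.
apply: (@nondecreasing_deriv _
  (fun y => e * (2 + e) * psi e (2 - e) y - wnum e y)
  (fun y => e * (2 + e) *
     (dpsi e (2 - e) y - sinh ((1 + e) * y) * sinh y))) => //.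
  move=> y _; eapply has_deriv_eq.
    apply: deriv_add; last by apply: deriv_opp; exact: deriv_wnum.
    by apply: deriv_mul; [exact: deriv_cst | exact: deriv_psi].
  by cbv beta; ring.
move=> y /andP[hy _]; have y0 := ltW hy.
apply: mulr_ge0; first by rewrite mulr_ge0 //; lra.
have q0 := psi_den_gt0 y k0; rewrite /dpsi.
rewrite subr_ge0 ler_pdivlMr ?exprn_gt0 //.
have S0 := sinh_ge0 y0; have K1 := cosh_ge1 y.
have X0 : 0 <= sinh ((1 + e) * y) by apply: sinh_ge0; apply: mulr_ge0 => //;
  lra.
have d1 : 1 <= 1 + e by lra.
have := tanh_scale d1 y0; have := cosh_sqr y.
move: q0 S0 K1 X0.
set S := sinh y; set K := cosh y; set X := sinh ((1 + e) * y);
  set Y := cosh ((1 + e) * y).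
move=> q0 S0 K1 X0 K2 XY.
rewrite [X * S]mulrC -[leLHS]mulrA ler_wpM2l //.
suff h : X * (3 + (6 * (2 - e) - 9) * S ^+ 2 + (2 - e) * (1 - e) * S ^+ 4)
    <= (3 + (2 - e) * S ^+ 2) * K * ((1 + e) * Y * S) by lra.
apply: (@le_trans _ _ ((3 + (2 - e) * S ^+ 2) * K * (X * K))); last first.
  by rewrite ler_wpM2l // mulr_ge0 ?(ltW q0) // (le_trans ler01).
have -> : (3 + (2 - e) * S ^+ 2) * K * (X * K) =
  X * ((3 + (2 - e) * S ^+ 2) * K ^+ 2) by ring.
rewrite ler_wpM2l // K2.
have y2 : 0 <= S ^+ 2 := sqr_ge0 S.
have : 0 <= S ^+ 2 * (2 + 5 * e + e * (2 - e) * S ^+ 2).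
  by rewrite mulr_ge0 // addr_ge0 //; [lra | rewrite mulr_ge0 // mulr_ge0 //;
    lra].
by lra.
Qed.

(** As for [wnum_le_psi], except that cosh ((1 + e) t) is now bounded from above, by means of
    [sinh_scale]. The bound on [e] makes the coefficients of the remaining polynomial
    nonnegative. *)
Lemma psi_le_wnum e t : 0 < e -> e <= 1 / 7 -> 0 <= t ->
  e * (2 + e) * psi e (3 - 3 * e) t <= wnum e t.
Proof.
move=> e_gt0 e_le t0; have e0 := ltW e_gt0; rewrite -subr_ge0.
have -> : 0 = wnum e 0 - e * (2 + e) * psi e (3 - 3 * e) 0
  by rewrite psi0 wnum0; ring.
have k0 : 0 <= 3 - 3 * e by lra.
apply: (@nondecreasing_deriv _
  (fun y => wnum e y - e * (2 + e) * psi e (3 - 3 * e) y)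
  (fun y => e * (2 + e) *
     (sinh ((1 + e) * y) * sinh y - dpsi e (3 - 3 * e) y))) => //.
  move=> y _; eapply has_deriv_eq.
    apply: deriv_add; first exact: deriv_wnum.
    by apply: deriv_opp; apply: deriv_mul;
      [exact: deriv_cst | exact: deriv_psi].
  by cbv beta; ring.
move=> y /andP[hy _]; have y0 := ltW hy.
apply: mulr_ge0; first by rewrite mulr_ge0 //; lra.
have q0 := psi_den_gt0 y k0; rewrite /dpsi.
rewrite subr_ge0 ler_pdivrMr ?exprn_gt0 //.
have S0 := sinh_ge0 y0; have K1 := cosh_ge1 y.
have X0 : 0 <= sinh ((1 + e) * y) by apply: sinh_ge0; apply: mulr_ge0 => //;
  lra.
have w0 : 0 <= 1 - e by lra.
have wd : 1 - e <= 1 + e by lra.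
have := sinh_scale w0 wd y0; have K2 := cosh_sqr y.
(* The addition formulas turn [sinh_scale] into an upper bound for sinh y cosh y cosh ((1 + e)
   y). *)
have -> : (1 - e) * y = y + y - (1 + e) * y by ring.
rewrite sinhD sinhN coshN sinhD coshD.
move: q0 S0 K1 X0 K2.
set S := sinh y; set K := cosh y; set X := sinh ((1 + e) * y);
  set Y := cosh ((1 + e) * y).
move=> q0 S0 K1 X0 K2 XY.
rewrite [X * S]mulrC -[leRHS]mulrA ler_wpM2l //.
have {}XY : (1 + e) * (S * K * Y) <= X * (1 + (1 + e) * S ^+ 2).
  have E : K * K = 1 + S ^+ 2 by rewrite -K2.
  by move: XY; rewrite E; lra.
suff h : (3 + (3 - 3 * e) * S ^+ 2) * ((1 + e) * (S * K * Y)) <=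
  X * (3 + (6 * (3 - 3 * e) - 9) * S ^+ 2 + (3 - 3 * e) * (2 - 3 * e) * S ^+ 4)
    by lra.
apply: (@le_trans _ _ ((3 + (3 - 3 * e) * S ^+ 2) *
  (X * (1 + (1 + e) * S ^+ 2)))).
  by rewrite ler_wpM2l // ltW.
rewrite mulrCA ler_wpM2l //.
have y2 : 0 <= S ^+ 2 := sqr_ge0 S.
have : 0 <= S ^+ 2 * (3 - 18 * e + (3 - 3 * e) * (1 - 4 * e) * S ^+ 2).
  by rewrite mulr_ge0 // addr_ge0 //; [lra | rewrite mulr_ge0 // mulr_ge0 //;
    lra].
by lra.
Qed.

End SlopeInequalities.

(** * Limits at 0 and at infinity *)

Section Limits.
Context {R : realType}.
Implicit Types (g : R -> R) (t x : R).

(** By continuity at 0. It is applied to minorants [g] that are regular at 0, of functions whose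
    formulas read 0 / 0 there. *)
Lemma le_right0 g dg t c : 0 < t -> has_deriv g 0 dg ->
  (forall s, 0 < s < t -> g s <= c) -> g 0 <= c.
Proof.
rewrite has_derivE => t0 [dg0 _] H; rewrite leNgt; apply/negP => cg.
have gc : {for (0 : R), continuous g}.
  exact/differentiable_continuous/derivable1_diffP.
have : nbhs (0 : R) [set x | c < g x] by exact: cvgr_gt gc _ cg.
move=> /nbhs_ballP [r /= r0 hr].
set s := Num.min (r / 2) (t / 2).
have s0 : 0 < s by rewrite lt_min !divr_gt0.
have sr : s < r by rewrite gt_min; apply/orP; left; lra.
have st : s < t by rewrite gt_min; apply/orP; right; lra.
have := H s; rewrite s0 st => /(_ isT); apply/negP; rewrite -ltNge.
by apply: hr; rewrite /ball /= sub0r normrN gtr0_norm.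
Qed.

(** Replaces a limit for T tending to infinity. The rate concerns [z ^+ 2] because the bounds in use
    are fractional powers whose squares are easily compared with 1 / T. *)
Lemma le0_vanishing x t :
  (forall T, t <= T -> 0 < T -> exists2 z, x <= z & z ^+ 2 <= T^-1) -> x <= 0.
Proof.
move=> H; rewrite leNgt; apply/negP => x0.
pose T := Num.max t (2 / x ^+ 2).
have x2 : 0 < x ^+ 2 by rewrite exprn_gt0.
have T2 : 2 / x ^+ 2 <= T by rewrite le_max lexx orbT.
have T0 : 0 < T by apply: lt_le_trans T2; rewrite divr_gt0.
have tT : t <= T by rewrite le_max lexx.
have [z xz z2] := H T tT T0.
have : x ^+ 2 <= T^-1 by apply: le_trans z2;
  rewrite lerXn2r ?nnegrE // ?(ltW x0) // (le_trans (ltW x0)).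
move: T2; rewrite ler_pdivrMr // => h1.
rewrite -(ler_pM2l T0) mulfV ?gt_eqF // => h2; lra.
Qed.

End Limits.

(** * Monotonicity in the hyperbolic parameter *)

Section ParametrizedFunctions.
Context {R : realType}.
Implicit Types e t s : R.

(* With [u = tanh t ^+ 2]: [gfun e t `^ (1 - e) = h_fun (1 - e) (cosh t)^-1],
   [pfun e] is [- d(gfun e)/du] divided by [acst e], and [wfun e] is
   [(1 - u) * d(pfun e)/du]. *)
Definition coshp e t : R := cosh t `^ (1 + e).

Definition pfun e t := coshp e t * sinh (e * t) / (e * sinh t).

Definition wfun e t := coshp e t * wnum e t / (2 * e * sinh t ^+ 3).

Definition gfun e t := 2 `^ e * (cosh ((1 - e) * t) * coshp e t / cosh t ^+ 2)
  - 1.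

Definition acst e : R := 2 `^ e * (1 - e) * e / 2.

Lemma coshp_gt0 e t : 0 < coshp e t.
Proof. exact/powR_gt0/cosh_gt0. Qed.

Lemma coshp0 e : coshp e 0 = 1.
Proof. by rewrite /coshp cosh0 powR1. Qed.

Lemma coshp_ge e t : 0 <= e -> cosh t <= coshp e t.
Proof.
move=> e0; have e1 : 1 <= 1 + e by rewrite lerDl.
by have := ler_powR (cosh_ge1 t) e1; rewrite powRr1 // ltW // cosh_gt0.
Qed.

Lemma deriv_coshp e t : has_deriv (coshp e) t ((1 + e) * coshp e t * sinh t /
  cosh t).
Proof. by rewrite /coshp; apply: deriv_powR (cosh_gt0 t) (deriv_cosh1 t). Qed.

Lemma deriv_invc t : has_deriv (fun y : R =>
  (cosh y)^-1) t (- sinh t / cosh t ^+ 2).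
Proof. by apply: deriv_inv (deriv_cosh1 t); rewrite gt_eqF ?cosh_gt0. Qed.

Hint Resolve deriv_coshp deriv_invc deriv_wnum : deriv.

Lemma deriv_invs t : 0 < t -> has_deriv (fun y : R =>
  (sinh y)^-1) t (- cosh t / sinh t ^+ 2).
Proof. by move=> t0; apply: deriv_inv (deriv_sinh1 t);
  rewrite gt_eqF ?sinh_gt0. Qed.

(** For u = tanh^2 t one has du/dt = 2 (1 - u) tanh t, and [wfun] absorbs the factor 1 - u. *)
Lemma deriv_pfun e t : 0 < e -> 0 < t ->
  has_deriv (pfun e) t (2 * (sinh t / cosh t) * wfun e t).
Proof.
move=> e0 t0.
have -> : pfun e = fun y => coshp e y * sinh (e * y) * (e^-1 * (sinh y)^-1).
  by apply/funext => y; rewrite /pfun invfM.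
eapply has_deriv_eq.
  apply: deriv_mul; last by apply: deriv_mul (deriv_cst _ _) (deriv_invs t0).
  exact: deriv_mul (deriv_coshp e t) (deriv_sinh e t).
cbv beta; rewrite /wfun /wnum.
have -> : (2 + e) * t = t + t + e * t by ring.
rewrite !sinhD !coshD.
have K2 := cosh_sqr t; have K0 := lt0r_neq0 (cosh_gt0 t);
  have S0 := lt0r_neq0 (sinh_gt0 t0).
have e0' := lt0r_neq0 e0.
move: K2 K0 S0; set S := sinh t; set K := cosh t; set X := sinh (e * t);
  set Y := cosh (e * t) => K2 K0 S0.
have E : K * K = 1 + S * S by rewrite -!expr2.
set P := coshp e t.
transitivity (P / (e * S ^+ 2 * K) * ((1 + e) * S ^+ 2 * X + e * Y * S * K - (K
  * K) * X)).
  by field; rewrite S0 e0' K0.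
rewrite E; transitivity (P / (e * S ^+ 2 * K) * ((e * (S * K * Y *+ 2 + (K * K
  + S * S) * X) - (2 + e) * X) / 2)); rewrite ?E.
  by congr (_ * _); field.
by field; rewrite S0 e0' K0.
Qed.

Lemma deriv_gfun e t : has_deriv (gfun e) t
  (- (2 `^ e * (1 - e) * (sinh (e * t) * coshp e t / cosh t ^+ 3))).
Proof.
have -> : gfun e = fun y => 2 `^ e * (cosh ((1 - e) * y) * coshp e y * ((cosh
  y)^-1) ^+ 2) - 1.
  by apply/funext => y; rewrite /gfun exprVn.
deriv; rewrite /=.
have -> : (1 - e) * t = t - e * t by ring.
rewrite sinhD coshD sinhN coshN.
have K2 := cosh_sqr t; have K0 := lt0r_neq0 (cosh_gt0 t).
move: K2 K0; set S := sinh t; set K := cosh t; set X := sinh (e * t);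
  set Y := cosh (e * t) => K2 K0.
set P := coshp e t; set A := 2 `^ e.
transitivity (- (A * (1 - e) * P * X / K ^+ 3 * (K ^+ 2 - S ^+ 2)));
  first by field.
by rewrite K2; field.
Qed.

(** The right-hand side suits computations but divides by [sinh t] inside [pfun]; the left-hand side
    is the derivative of [gfun] at 0 as well. *)
Lemma deriv_gfunE e t : 0 < e -> 0 < t ->
  - (2 `^ e * (1 - e) * (sinh (e * t) * coshp e t / cosh t ^+ 3)) =
  - (2 * acst e * (sinh t * pfun e t / cosh t ^+ 3)).
Proof.
move=> e0 t0; rewrite /acst /pfun; field.
by rewrite !gt_eqF ?cosh_gt0 ?sinh_gt0.
Qed.

Lemma deriv_wfun e t : 0 < e -> 0 < t ->
  has_deriv (wfun e) t (coshp e t / (2 * e * sinh t ^+ 4 * cosh t) *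
    (e * (2 + e) * (sinh ((1 + e) * t) * (sinh t ^+ 2 * cosh t))
     - wnum e t * (3 + (2 - e) * sinh t ^+ 2))).
Proof.
move=> e0 t0.
have -> : wfun e = fun y => coshp e y * wnum e y * ((2 * e)^-1 * ((sinh y)^-1)
  ^+ 3).
  by apply/funext => y; rewrite /wfun invfM exprVn.
eapply has_deriv_eq.
  apply: deriv_mul; last by apply: deriv_mul (deriv_cst _ _) (deriv_exp _
    (deriv_invs t0)).
  exact: deriv_mul (deriv_coshp e t) (deriv_wnum e t).
rewrite /=.
have K2 := cosh_sqr t; have K0 := lt0r_neq0 (cosh_gt0 t);
  have S0 := lt0r_neq0 (sinh_gt0 t0).
have e0' := lt0r_neq0 e0.
move: K2 K0 S0; set S := sinh t; set K := cosh t;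
  set X := sinh ((1 + e) * t) => K2 K0 S0.
set P := coshp e t; set N := wnum e t.
transitivity (P / (2 * e * S ^+ 4 * K) * (e * (2 + e) * (X * (S ^+ 2 * K)) - N
  * (3 * K ^+ 2 - (1 + e) * S ^+ 2))).
  by field; rewrite S0 e0' K0.
by rewrite K2; congr (_ * _); ring.
Qed.

Lemma wfun_le e s t : 0 < e -> e <= 1 / 7 -> 0 < s -> s <= t -> wfun e s <=
  wfun e t.
Proof.
move=> e0 e7 s0 st; apply: (@nondecreasing_deriv _ _ _ _ _ st).
  by move=> x /andP[sx _]; apply: deriv_wfun => //; exact: lt_le_trans sx.
move=> x /andP[sx _] /=; have x0 := lt_trans s0 sx.
have S0 := sinh_gt0 x0; have K0 := cosh_gt0 x.
apply: mulr_ge0.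
  by rewrite ltW // divr_gt0 ?coshp_gt0 // !mulr_gt0 ?exprn_gt0.
have k0 : 0 <= 2 - e by lra.
have := wnum_le_psi e0 e7 (ltW x0);
  rewrite /psi mulrA ler_pdivlMr ?psi_den_gt0 //.
by rewrite subr_ge0.
Qed.

(** With w = (1 - u) p', the inequality (1 - 2 e) p' - 2 w' >= 0 says that (1 - u)^(3/2 - e) p' is
    nonincreasing in u. It follows from [psi_le_wnum]. *)
Lemma pfun_wfun_le e s t : 0 < e -> e <= 1 / 7 -> 0 < s -> s <= t ->
  (1 - 2 * e) * pfun e s - 2 * wfun e s <=
    (1 - 2 * e) * pfun e t - 2 * wfun e t.
Proof.
move=> e0 e7 s0 st.
apply: (@nondecreasing_deriv _ (fun x =>
  (1 - 2 * e) * pfun e x - 2 * wfun e x) _ _ _ st).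
  move=> x /andP[sx _]; have x0 := lt_le_trans s0 sx.
  apply: deriv_add; first exact: deriv_mul (deriv_cst _ _) (deriv_pfun e0 x0).
  by apply: deriv_opp; apply: deriv_mul (deriv_cst _ _) (deriv_wfun e0 x0).
move=> x /andP[sx _] /=; have x0 := lt_trans s0 sx.
have S0 := sinh_gt0 x0; have K0 := cosh_gt0 x.
have k0 : 0 <= 3 - 3 * e by lra.
have := psi_le_wnum e0 e7 (ltW x0);
  rewrite /psi mulrA ler_pdivrMr ?psi_den_gt0 //.
rewrite /wfun; have P0 := coshp_gt0 e x.
move: S0 K0 P0; set S := sinh x; set K := cosh x; set P := coshp e x;
  set N := wnum e x.
set X := sinh _ => S0 K0 P0 H.
have -> : 0 * pfun e x + (1 - 2 * e) * (2 * (S / K) * (P * N / (2 * e * S ^+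
  3))) -
    (0 * (P * N / (2 * e * S ^+ 3)) + 2 * (P / (2 * e * S ^+ 4 * K) *
     (e * (2 + e) * (X * (S ^+ 2 * K)) - N * (3 + (2 - e) * S ^+ 2))))
  = P / (e * S ^+ 4 * K) * (N * (3 + (3 - 3 * e) * S ^+ 2) - e * (2 + e) * (X *
    (S ^+ 2 * K))).
  by field; rewrite !gt_eqF.
apply: mulr_ge0; first by rewrite ltW // divr_gt0 ?mulr_gt0 ?exprn_gt0.
by rewrite subr_ge0.
Qed.

Lemma pfun_ge1 e t : 0 < e -> 0 < t -> 1 <= pfun e t.
Proof.
move=> e0 t0; have S0 := sinh_gt0 t0.
rewrite /pfun ler_pdivlMr ?mulr_gt0 // mul1r.
apply: (@le_trans _ _ (e * (t * cosh t)));
  first by rewrite ler_pM2l // sinh_le_cosh ?ltW.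
have et0 := mulr_gt0 e0 t0; rewrite mulrA [leLHS]mulrC.
by apply: ler_pM; rewrite ?coshp_ge ?sinh_ge ?(ltW (cosh_gt0 _)) // ltW.
Qed.

Lemma pfun_le e t : 0 < e -> e <= 1 -> 0 < t -> pfun e t <= coshp e t.
Proof.
move=> e0 e1 t0; have S0 := sinh_gt0 t0.
rewrite /pfun ler_pdivrMr ?mulr_gt0 // ler_pM2l ?coshp_gt0 //.
by have := @sinh_scale _ e 1 t (ltW e0) e1 (ltW t0); rewrite !mul1r.
Qed.

(** The bound is regular at 0, where it equals the limit of [wfun e]; hence it is sharp enough for a
    passage to the limit. *)
Lemma wfun_ub e t : 0 < e -> e <= 1 / 7 -> 0 < t ->
  wfun e t <= (2 + e) * (1 + e) / 6 * (coshp e t * cosh ((1 + e) * t)).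
Proof.
move=> e0 e7 t0; have S0 := sinh_gt0 t0; have K0 := cosh_gt0 t;
  have P0 := coshp_gt0 e t.
have k0 : 0 <= 2 - e by lra.
have := wnum_le_psi e0 e7 (ltW t0);
  rewrite /psi mulrA ler_pdivlMr ?psi_den_gt0 //.
have d1 : 1 <= 1 + e by lra.
have := tanh_scale d1 (ltW t0).
have N0 : 0 <= wnum e t.
  rewrite -(wnum0 e); apply: (@nondecreasing_deriv _ _ _ _ _ (ltW t0)).
    by move=> x _; exact: deriv_wnum.
  move=> x /andP[x0 _] /=; rewrite !mulr_ge0 ?sinh_ge0 ?mulr_ge0 ?ltW //; lra.
rewrite /wfun; move: S0 K0 P0 N0.
set S := sinh t; set K := cosh t; set P := coshp e t; set N := wnum e t.
set X := sinh _; set Y := cosh _ => S0 K0 P0 N0 H1 H2.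
have H3 : 3 * N <= e * (2 + e) * ((1 + e) * Y * S * S ^+ 2).
  have h1 : N * 3 <= N * (3 + (2 - e) * S ^+ 2).
    by rewrite ler_wpM2l // lerDl mulr_ge0 // sqr_ge0.
  have h2 : e * (2 + e) * (X * K * S ^+ 2) <=
    e * (2 + e) * ((1 + e) * Y * S * S ^+ 2).
    rewrite ler_wpM2l ?mulr_ge0 ?(ltW e0) //; first by lra.
    by rewrite ler_wpM2r ?sqr_ge0.
  lra.
rewrite ler_pdivrMr ?mulr_gt0 ?exprn_gt0 //.
rewrite -subr_ge0.
have -> : (2 + e) * (1 + e) / 6 * (P * Y) * (2 * e * S ^+ 3) - P * N =
  P / 3 * (e * (2 + e) * ((1 + e) * Y * S * S ^+ 2) - 3 * N) by field.
by rewrite mulr_ge0 ?divr_ge0 ?(ltW P0) // subr_ge0.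
Qed.

(* [pfun e - 2 * wfun e] and [pfun e] tend to [(1 - 3 * e - e ^+ 2) / 3] and
   [1] at 0, so this compares a monotone combination with its value at 0. *)
Lemma pfun_wfun_lb e t : 0 < e -> e <= 1 / 7 -> 0 < t ->
  (1 - 3 * e - e ^+ 2) / 3 + 2 * e * (pfun e t - 1) <= pfun e t - 2 * wfun e t.
Proof.
move=> e0 e7 t0.
(* A minorant regular at 0: [pfun] is replaced by 1 and [wfun] by the bound in [wfun_ub]. *)
pose g s := (1 - 2 * e) - (2 + e) * (1 + e) / 3 * (coshp e s * cosh ((1 + e) *
  s)).
have H : g 0 <= (1 - 2 * e) * pfun e t - 2 * wfun e t.
  apply: (@le_right0 _ g _ t _ t0).
    by rewrite /g; repeat (solve [eauto with deriv] || deriv_step).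
  move=> s /andP[s0 st].
  apply: le_trans (pfun_wfun_le e0 e7 s0 (ltW st)).
  have := wfun_ub e0 e7 s0; have := pfun_ge1 e0 s0; rewrite /g => h1 h2.
  have h3 : (1 - 2 * e) * 1 <= (1 - 2 * e) * pfun e s by rewrite ler_wpM2l //;
    lra.
  lra.
move: H; rewrite /g coshp0 mulr0 cosh0; lra.
Qed.

End ParametrizedFunctions.
#[global] Hint Resolve deriv_coshp deriv_invc deriv_wnum : deriv.

(** * Numerical bounds at theta = 1 *)

Section Threshold.
Context {R : realType}.
Implicit Types e x : R.

(** Five terms of the series of 2 artanh x at x = 1/3, where 2 artanh x = ln 2. The remainder has
    the derivative 2 x^10 / (1 - x^2). *)
Lemma ln2_lb : (693 * 1000 + 146) / 10 ^+ 6 <= ln 2 :> R.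
Proof.
pose f (x : R) := ln (1 + x) - ln (1 - x)
  - 2 * (x + x ^+ 3 / 3 + x ^+ 5 / 5 + x ^+ 7 / 7 + x ^+ 9 / 9).
have : f 0 <= f (3^-1).
  apply: (@nondecreasing_deriv _ f (fun x =>
    2 * x ^+ 10 / ((1 + x) * (1 - x)))).
  - by lra.
  - move=> x /andP[x0 x1].
    have h1 : 0 < 1 + x by lra.
    have h2 : 0 < 1 - x by lra.
    eapply has_deriv_eq.
      apply: deriv_add.
        apply: deriv_add; [apply: (@deriv_ln _ (fun y =>
          1 + y) _ _ h1) | apply: deriv_opp;
          apply: (@deriv_ln _ (fun y => 1 - y) _ _ h2)];
        by repeat deriv_step.
      by repeat deriv_step.
    rewrite /=; field; rewrite !gt_eqF //=.
  - move=> x /andP[x0 x1]; rewrite divr_ge0 ?mulr_ge0 ?exprn_ge0 //; lra.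
rewrite /f addr0 subr0 ln1.
have -> : 1 + 3^-1 = 2 * (1 - 3^-1) :> R by field.
have h : 0 < 1 - 3^-1 :> R by lra.
rewrite lnM ?posrE // addrK; lra.
Qed.

Lemma expR_taylor4_le x : 0 <= x ->
  1 + x + x ^+ 2 / 2 + x ^+ 3 / 6 + x ^+ 4 / 24 <= expR x.
Proof.
move=> x0.
have step (f g : R -> R) : (forall y, has_deriv f y (g y)) -> f 0 = 1 ->
    (forall y, 0 <= y -> g y <= expR y) -> forall y, 0 <= y -> f y <= expR y.
  move=> fg f0 gle y y0; rewrite -subr_ge0.
  have -> : 0 = expR 0 - f 0 by rewrite f0 expR0 subrr.
  apply: (@nondecreasing_deriv _ (fun z => expR z - f z) (fun z =>
    expR z - g z)) => //.
    move=> z _; eapply has_deriv_eq.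
      apply: deriv_add; first by apply: (deriv_expR (deriv_id z)).
      by apply: deriv_opp; exact: fg.
    by rewrite mulr1.
  by move=> z /andP[z0 _]; rewrite subr_ge0 gle // ltW.
apply: (step (fun y => 1 + y + y ^+ 2 / 2 + y ^+ 3 / 6 + y ^+ 4 / 24)
  (fun y => 1 + y + y ^+ 2 / 2 + y ^+ 3 / 6)) => //.
- by move=> y; deriv; rewrite /=; field.
- by rewrite !expr0n /=; field.
apply: (step (fun y => 1 + y + y ^+ 2 / 2 + y ^+ 3 / 6) (fun y =>
  1 + y + y ^+ 2 / 2)).
- by move=> y; deriv; rewrite /=; field.
- by rewrite !expr0n /=; field.
apply: (step (fun y => 1 + y + y ^+ 2 / 2) (fun y => 1 + y)).
- by move=> y; deriv; rewrite /=; field.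
- by rewrite !expr0n /=; field.
by move=> y _; exact: expR_ge1Dx.
Qed.

(* This is where the constant 0.85798 comes from: the inequality says that the
   second derivative of h_omega is nonnegative at theta = 1.  The bound m is a
   variable because unification may unfold the unary numerals in it. *)
Lemma threshold m e : m = (14 * 1000 + 202) / 10 ^+ 5 -> 0 < e -> e <= m ->
  3 * 2 `^ e * e ^+ 2 * (1 - e) <= (2 `^ e - 1) * (1 - 3 * e - e ^+ 2).
Proof.
move=> mE e0 e1; have m0 : 0 <= m by rewrite mE; lra.
pose L : R := (693 * 1000 + 146) / 10 ^+ 6.
have L0 : 0 <= L by rewrite /L; lra.
(* The Taylor polynomial of degree 4 of the exponential at [L * e]. *)
pose T := 1 + L * e * (1 + (L * e) / 2 + (L * e) ^+ 2 / 6 + (L * e) ^+ 3 / 24).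
have Ta : T <= 2 `^ e.
  rewrite /powR pnatr_eq0 /=.
  have Le : 0 <= L * e by rewrite mulr_ge0 // ltW.
  apply: (le_trans (y := expR (L * e))).
    apply: le_trans (expR_taylor4_le Le); rewrite /T; lra.
  by rewrite ler_expR mulrC ler_pM2l // ln2_lb.
(* This is the coefficient of 2^e in the difference of the two sides, so 2^e may be replaced by its
   lower bound [T]. *)
have M0 : 0 <= (1 - 3 * e - e ^+ 2) - 3 * e ^+ 2 * (1 - e).
  have e7 : e <= 1 / 7 by rewrite mE in e1; lra.
  by nra.
have H : 3 * T * e ^+ 2 * (1 - e) <= (T - 1) * (1 - 3 * e - e ^+ 2).
  have e2 : 0 <= e ^+ 2 by rewrite sqr_ge0.
  (* [t3], [t4] and [t5] place the third to fifth powers of [e] above their tangents at [m]; [t2]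
     places the square below its chord on [0, m]. With these, [lra] can treat the powers as
     independent unknowns. *)
  have t3 : 0 <= (e - m) ^+ 2 * (e + 2 * m).
    by rewrite mulr_ge0 ?sqr_ge0 // addr_ge0 ?mulr_ge0 // ltW.
  have t4 : 0 <= (e - m) ^+ 2 * (e ^+ 2 + 2 * m * e + 3 * m ^+ 2).
    by rewrite mulr_ge0 ?sqr_ge0 // !addr_ge0 ?mulr_ge0 ?exprn_ge0 // ltW.
  have t5 : 0 <= (e - m) ^+ 2 * (e ^+ 3 + 2 * m * e ^+ 2 + 3 * m ^+ 2 * e + 4 *
    m ^+ 3).
    by rewrite mulr_ge0 ?sqr_ge0 // !addr_ge0 ?mulr_ge0 ?exprn_ge0 // ltW.
  have t2 : 0 <= e * (m - e) by rewrite mulr_ge0 ?(ltW e0) // subr_ge0.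
  have t6 : 0 <= e ^+ 6 by rewrite exprn_ge0 // ltW.
  rewrite -subr_ge0.
  have -> : (T - 1) * (1 - 3 * e - e ^+ 2) - 3 * T * e ^+ 2 * (1 - e) =
    e * ((T - 1) / e * (1 - 3 * e - e ^+ 2) - 3 * T * e * (1 - e)).
    by field; rewrite gt_eqF.
  rewrite mulr_ge0 ?(ltW e0) //.
  have -> : (T - 1) / e = L * (1 + (L * e) / 2 + (L * e) ^+ 2 / 6 + (L * e) ^+
    3 / 24).
    by rewrite /T; field; rewrite gt_eqF.
  rewrite mE in t2 t3 t4 t5.
  rewrite /T /L; lra.
have : 0 <= (2 `^ e - T) * ((1 - 3 * e - e ^+ 2) - 3 * e ^+ 2 * (1 - e)).
  by rewrite mulr_ge0 // subr_ge0.
lra.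
Qed.

End Threshold.

(** * Support lines of h_omega and Jensen's inequality *)

Section SupportLines.
Context {R : realType}.
Implicit Types e t x : R.

Lemma coshp_split e t : 0 < e -> e < 1 ->
  cosh t `^ (1 - e) * coshp e t = cosh t ^+ 2.
Proof.
move=> e0 e1; have c0 : cosh t != 0 by rewrite gt_eqF ?cosh_gt0.
rewrite /coshp -powRD ?c0 ?implybT //.
have -> : 1 - e + (1 + e) = 2 by ring.
by rewrite -powR_mulrn // ltW // cosh_gt0.
Qed.

(** The two bases are (1 + tanh t) / 2 and (1 - tanh t) / 2, the eigenvalues of a reduced state of
    concurrence 1 / cosh t. *)
Lemma gfunE e t : 0 < e -> e < 1 -> gfun e t =
  (expR t / (2 * cosh t)) `^ (1 - e) + (expR (- t) / (2 * cosh t)) `^ (1 - e) -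
    1.
Proof.
move=> e0 e1; have K0 := cosh_gt0 t; have P0 := coshp_gt0 e t.
have c0 : 0 <= (2 * cosh t)^-1 by rewrite invr_ge0 mulr_ge0 // ltW.
rewrite !powRM ?expR_ge0 // -!expRM -mulrDl.
have -> : (2 * cosh t)^-1 `^ (1 - e) = 2 `^ e / 2 * (coshp e t / cosh t ^+ 2).
  rewrite -powR_inv1 ?mulr_ge0 ?(ltW K0) // powRAC powR_inv1 ?powR_ge0 //.
  rewrite powRM ?(ltW K0) // powRB ?pnatr_eq0 ?implybT // powRr1 //.
  rewrite -(coshp_split t e0 e1); field.
  by rewrite !gt_eqF ?powR_gt0.
have -> : t * (1 - e) = (1 - e) * t by ring.
have -> : - t * (1 - e) = - ((1 - e) * t) by ring.
by rewrite /gfun [cosh (_ * _)]coshE; field; rewrite gt_eqF.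
Qed.

Lemma gfun_ge0 e t : 0 < e -> e < 1 -> 0 <= gfun e t.
Proof.
move=> e0 e1; rewrite (gfunE _ e0 e1) subr_ge0; have K0 := cosh_gt0 t.
have E : expR t / (2 * cosh t) + expR (- t) / (2 * cosh t) = 1.
  by rewrite -mulrDl; move: K0; rewrite coshE => K0; field; rewrite gt_eqF //;
    lra.
have h1 : 0 < expR t / (2 * cosh t) by rewrite divr_gt0 ?expR_gt0 ?mulr_gt0.
have h2 : 0 < expR (- t) / (2 * cosh t) by rewrite divr_gt0 ?expR_gt0 ?mulr_gt0.
rewrite -{1}E lerD // ger1_powR ?h1 ?h2 //=; lra.
Qed.

Lemma gfun0 e : gfun e 0 = 2 `^ e - 1.
Proof. by rewrite /gfun mulr0 cosh0 coshp0; field. Qed.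

Lemma acst_gt0 e : 0 < e -> e < 1 -> 0 < acst e.
Proof.
by move=> e0 e1; rewrite /acst divr_gt0 // !mulr_gt0 ?powR_gt0 // subr_gt0.
Qed.

Lemma two_powR_gt1 e : 0 < e -> 1 < 2 `^ e.
Proof. by move=> e0; rewrite /powR pnatr_eq0 /= expR_gt1 mulr_gt0 // ln_gt0 //
  ltr1n. Qed.

(** The square is a power of cosh t with exponent 2 e - 2 <= -1, and cosh t >= sinh t >= t. *)
Lemma coshp_vanishing e t : 0 < e -> e <= 1 / 7 -> 0 < t ->
  (coshp e t / cosh t ^+ 2) ^+ 2 <= t^-1.
Proof.
move=> e0 e7 t0; have K0 := cosh_gt0 t; have K1 := cosh_ge1 t.
have h : coshp e t ^+ 2 <= cosh t ^+ 3.
  have h1 : (1 + e) * 2 <= 3%:R :> R by lra.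
  by have := ler_powR K1 h1; rewrite powRrM !powR_mulrn ?powR_ge0 ?(ltW K0).
apply: (@le_trans _ _ ((cosh t)^-1)).
  rewrite exprMn exprVn -exprM ler_pdivrMr ?exprn_gt0 //.
  by have -> : (cosh t)^-1 * cosh t ^+ 4 = cosh t ^+ 3 by field; rewrite gt_eqF.
rewrite lef_pV2 ?posrE //; apply: (le_trans (sinh_ge (ltW t0))).
have S0 := sinh_ge0 (ltW t0).
by rewrite -(@ler_pXn2r _ 2) ?nnegrE ?(ltW K0) // cosh_sqr lerDr.
Qed.

(* The difference of the two sides vanishes at 0 and at infinity, and it first
   increases and then decreases because [wfun e] is nondecreasing. *)
Lemma gfun_lb e t : 0 < e -> e <= 1 / 7 -> 0 < t ->
  2 `^ e - 1 + acst e * (pfun e t - 1) <= gfun e t * cosh t ^+ 2.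
Proof.
move=> e0 e7 t0; have e1 : e < 1 by lra.
have A0 := acst_gt0 e0 e1; have a1 := two_powR_gt1 e0.
pose F s := gfun e s - (2 `^ e - 1 - acst e + acst e * pfun e s) * ((cosh
  s)^-1) ^+ 2.
pose dF s := 2 * sinh s / cosh s ^+ 3 * (2 `^ e - 1 - acst e - acst e * wfun e
  s).
have DF s : 0 < s -> has_deriv F s (dF s).
  move=> s0; rewrite /F; eapply has_deriv_eq.
    apply: deriv_add; first exact: deriv_gfun.
    apply: deriv_opp; apply: deriv_mul; last exact: deriv_exp (deriv_invc s).
    apply: deriv_add; first exact: deriv_cst.
    by apply: deriv_mul (deriv_cst _ _) (deriv_pfun e0 s0).
  rewrite deriv_gfunE //= /dF; field.
  by rewrite gt_eqF ?cosh_gt0.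
suff F0 : 0 <= F t.
  have K0 := cosh_gt0 t; rewrite -subr_ge0.
  have -> : gfun e t * cosh t ^+ 2 - (2 `^ e - 1 + acst e * (pfun e t - 1)) =
    F t * cosh t ^+ 2.
    by rewrite /F; field; rewrite gt_eqF.
  by rewrite mulr_ge0 // exprn_ge0 // ltW.
have dF0 s : 0 < s -> 0 <= 2 * sinh s / cosh s ^+ 3.
  by move=> s0; rewrite divr_ge0 ?mulr_ge0 ?exprn_ge0 ?sinh_ge0 // ltW
    ?cosh_gt0.
have [wt|wt] := leP (acst e * wfun e t) (2 `^ e - 1 - acst e).
(* [F] increases up to [t]. As [pfun] divides by zero at 0, it is replaced by its majorant [coshp],
   which equals 1 there. *)
- pose g s := gfun e s - (2 `^ e - 1 - acst e + acst e * coshp e s) * ((cosh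
  s)^-1) ^+ 2.
  have -> : 0 = g 0 by rewrite /g gfun0 coshp0 cosh0 invr1; ring.
  apply: (@le_right0 _ g _ t _ t0).
    apply: deriv_add; first exact: deriv_gfun.
    apply: deriv_opp; apply: deriv_mul; last exact: deriv_exp (deriv_invc 0).
    by apply: deriv_add (deriv_cst _ _) (deriv_mul (deriv_cst _ _) (deriv_coshp
      e 0)).
  move=> s /andP[s0 st]; apply: (@le_trans _ _ (F s)).
    rewrite /g /F lerB // ler_wpM2r ?exprn_ge0 ?invr_ge0 ?(ltW (cosh_gt0 _)) //.
    by rewrite lerD2l ler_pM2l // pfun_le // ltW.
  apply: (@nondecreasing_deriv _ F dF _ _ (ltW st)).
    by move=> x /andP[sx _]; apply: DF; exact: lt_le_trans sx.
  move=> x /andP[sx xt]; have x0 := lt_trans s0 sx.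
  rewrite mulr_ge0 ?dF0 // subr_ge0; apply: le_trans wt.
  by rewrite ler_pM2l // wfun_le // ltW.
(* [F] decreases beyond [t], and [F T] is at least [- c] times a quantity that vanishes at
   infinity. *)
- pose c := 2 `^ e - 1 + acst e.
  have c0 : 0 < c by rewrite /c; lra.
  suff : - F t / c <= 0 by rewrite ler_pdivrMr // mul0r oppr_le0.
  apply: (@le0_vanishing _ _ t) => T tT T0.
  exists (coshp e T / cosh T ^+ 2); last exact: coshp_vanishing.
  rewrite ler_pdivrMr // lerNl.
  have FT : F T <= F t.
    apply: (@nonincreasing_deriv _ F dF _ _ tT).
      by move=> x /andP[tx _]; apply: DF; exact: lt_le_trans tx.
    move=> x /andP[tx _]; have x0 := lt_trans t0 tx.
    rewrite mulr_ge0_le0 ?dF0 // subr_le0; apply: le_trans (ltW wt) _.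
    by rewrite ler_pM2l // wfun_le // ltW.
  apply: le_trans FT; have K0 := cosh_gt0 T.
  have P1 : 1 <= coshp e T by apply: le_trans (cosh_ge1 T) (coshp_ge _ (ltW
    e0)).
  have := pfun_le e0 (ltW e1) T0; have := gfun_ge0 T e0 e1.
  rewrite /F exprVn /c; set P := coshp e T in P1 *; set p := pfun e T;
    set k := (_ ^+ 2)^-1.
  have k0 : 0 <= k by rewrite invr_ge0 exprn_ge0 // ltW.
  move=> G0 pP.
  have : 0 <= ((2 `^ e - 1 + acst e) * P - (2 `^ e - 1 - acst e + acst e * p))
    * k.
    rewrite mulr_ge0 // subr_ge0.
    have h1 : acst e * p <= acst e * P by rewrite ler_pM2l.
    have h2 : (2 `^ e - 1) * 1 <= (2 `^ e - 1) * P
      by rewrite ler_pM2l // subr_gt0.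
    lra.
  lra.
Qed.

Lemma gfun_gt0 e t : 0 < e -> e <= 1 / 7 -> 0 <= t -> 0 < gfun e t.
Proof.
move=> e0 e7; have e1 : e < 1 by lra.
have a1 := two_powR_gt1 e0; have A0 := acst_gt0 e0 e1.
rewrite le_eqVlt => /orP[/eqP <- | t0]; first by rewrite gfun0 subr_gt0.
have := gfun_lb e0 e7 t0; have := pfun_ge1 e0 t0 => p1 H.
have K0 := cosh_gt0 t.
rewrite -(pmulr_lgt0 _ (exprn_gt0 2 K0)); apply: lt_le_trans H.
by rewrite ltr_pwDl ?subr_gt0 // mulr_ge0 ?(ltW A0) // subr_ge0.
Qed.

(* The derivative of [h_fun (1 - e)] at [(cosh t)^-1]. *)
Definition slope e t : R :=
  2 * (1 - e) * acst e * (pfun e t * (gfun e t `^ (1 - e) * (gfun e t)^-1) *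
    (cosh t)^-1).

Lemma convexity_inequality m e t : m = (14 * 1000 + 202) / 10 ^+ 5 ->
  0 < e -> e <= m -> 0 < t ->
  2 * e * acst e * pfun e t ^+ 2 <=
    gfun e t * cosh t ^+ 2 * (pfun e t - 2 * wfun e t).
Proof.
move=> mE e0 em t0; have e7 : e <= 1 / 7 by rewrite mE in em; lra.
have e1 : e < 1 by lra.
have A0 := acst_gt0 e0 e1; have a1 := two_powR_gt1 e0.
have HG := gfun_lb e0 e7 t0; have HD := pfun_wfun_lb e0 e7 t0.
have p1 := pfun_ge1 e0 t0.
have HN : 2 * e * acst e <= (2 `^ e - 1) * ((1 - 3 * e - e ^+ 2) / 3).
  by have := threshold mE e0 em; rewrite /acst; lra.
move: HG HD p1; set g := gfun e t * _; set D := pfun e t - _; set p := pfun e t.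
move: HN A0 a1; set A := acst e; set a := 2 `^ e;
  set D0 := _ / 3 => HN A0 a1 HG HD p1.
have [q0 ->] : 0 <= p - 1 /\ p = 1 + (p - 1) by split;
  [rewrite subr_ge0 | ring].
move: q0 HG HD; set q := p - 1 => q0 HG HD.
have D00 : 0 < D0.
  by rewrite /D0 divr_gt0 //; nra.
(* This product and the left-hand side are quadratic in [q] with the same leading coefficient. The
   constant terms compare by [HN], the linear ones by [h] below. *)
apply: (@le_trans _ _ ((a - 1 + A * q) * (D0 + 2 * e * q))); last first.
  have Aq : 0 <= A * q by rewrite mulr_ge0 // ltW.
  have eq0 : 0 <= 2 * e * q by rewrite !mulr_ge0 // ltW.
  apply: ler_pM => //; first by apply: addr_ge0 => //; rewrite subr_ge0 ltW.
  by apply: addr_ge0 => //; exact: ltW.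
(* AM-GM *)
have h : 4 * e * A <= 2 * e * (a - 1) + D0 * A.
  rewrite -(ler_pM2r D00).
  have h1 : 0 <= A * (D0 - 2 * e) ^+ 2 by rewrite mulr_ge0 ?(ltW A0) // sqr_ge0.
  have h2 : 2 * e * (2 * e * A) <= 2 * e * ((a - 1) * D0)
    by rewrite ler_pM2l // mulr_gt0.
  lra.
have hq : 4 * e * A * q <= (2 * e * (a - 1) + D0 * A) * q by rewrite ler_wpM2r.
lra.
Qed.
Lemma slope_factor_ge0 e : 0 < e -> e < 1 -> 0 <= 2 * (1 - e) * acst e :> R.
Proof.
move=> e0 e1; apply: mulr_ge0; last exact/ltW/acst_gt0.
by rewrite mulr_ge0 // subr_ge0 ltW.
Qed.

(** The sign of the derivative is [convexity_inequality]. Since 1 / cosh t decreases in t, this is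
    the convexity of h_omega. *)
Lemma slope_nonincreasing m e s t : m = (14 * 1000 + 202) / 10 ^+ 5 ->
  0 < e -> e <= m -> 0 < s -> s <= t -> slope e t <= slope e s.
Proof.
move=> mE e0 em s0 st; have e7 : e <= 1 / 7 by rewrite mE in em; lra.
have e1 : e < 1 by lra.
pose k x := pfun e x * (gfun e x `^ (1 - e) * (gfun e x)^-1) * (cosh x)^-1.
suff : k t <= k s.
  by rewrite /slope => kk; rewrite ler_wpM2l // slope_factor_ge0.
pose dk x := gfun e x `^ (1 - e) / (gfun e x * cosh x) * (sinh x / cosh x) *
   (2 * e * acst e * pfun e x ^+ 2 - gfun e x * cosh x ^+ 2 * (pfun e x - 2 *
     wfun e x))
   / (cosh x ^+ 2 * gfun e x).
apply: (@nonincreasing_deriv _ k dk _ _ st).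
  move=> x /andP[sx _]; have x0 := lt_le_trans s0 sx.
  have G0 := gfun_gt0 e0 e7 (ltW x0); have K0 := cosh_gt0 x.
  have Dg := deriv_gfun e x; rewrite deriv_gfunE // in Dg.
  rewrite /k; eapply has_deriv_eq.
    apply: deriv_mul; last exact: deriv_invc.
    apply: deriv_mul; first exact: deriv_pfun e0 x0.
    apply: deriv_mul; first exact: deriv_powR G0 Dg.
    by apply: deriv_inv Dg; rewrite gt_eqF.
  by rewrite /dk; field; rewrite !gt_eqF.
move=> x /andP[sx _]; have x0 := lt_trans s0 sx.
have G0 := gfun_gt0 e0 e7 (ltW x0); have K0 := cosh_gt0 x;
  have S0 := sinh_gt0 x0.
rewrite /dk -mulrA mulr_ge0_le0 //.
  by rewrite ltW // mulr_gt0 ?divr_gt0 ?powR_gt0 ?mulr_gt0.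
rewrite mulr_le0_ge0 ?invr_ge0 ?mulr_ge0 ?exprn_ge0 ?(ltW G0) ?(ltW K0) //.
by rewrite subr_le0 (convexity_inequality mE).
Qed.

Lemma slope_ge0 e t : 0 < e -> e <= 1 / 7 -> 0 < t -> 0 <= slope e t.
Proof.
move=> e0 e7 t0; have e1 : e < 1 by lra.
have K0 := cosh_gt0 t; have p1 := pfun_ge1 e0 t0; have A0 := acst_gt0 e0 e1.
have G0 := gfun_gt0 e0 e7 (ltW t0).
apply: mulr_ge0; first exact: slope_factor_ge0.
apply: mulr_ge0; last by rewrite invr_ge0 ltW.
apply: mulr_ge0; first exact: le_trans p1.
by rewrite mulr_ge0 ?powR_ge0 ?invr_ge0 ?(ltW G0).
Qed.

(** After subtraction of the line, the derivative at x is a nonnegative multiple of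
    [slope e t - slope e x], so the minimum is at x = t. *)
Lemma support_line_param m e t T : m = (14 * 1000 + 202) / 10 ^+ 5 ->
  0 < e -> e <= m -> 0 < t -> 0 <= T ->
  gfun e t `^ (1 - e) + slope e t * ((cosh T)^-1 - (cosh t)^-1) <=
    gfun e T `^ (1 - e).
Proof.
move=> mE e0 em t0 T0; have e7 : e <= 1 / 7 by rewrite mE in em; lra.
pose f x := gfun e x `^ (1 - e) - slope e t * (cosh x)^-1.
suff : f t <= f T by rewrite /f; lra.
(* Free of [pfun], so that it is also the derivative at 0, as the case [T] = 0 requires. *)
pose dg x := - (2 `^ e * (1 - e) * (sinh (e * x) * coshp e x / cosh x ^+ 3)).
pose df x := (1 - e) * gfun e x `^ (1 - e) * dg x / gfun e x
  + slope e t * (sinh x / cosh x ^+ 2).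
have Df x : 0 <= x -> has_deriv f x (df x).
  move=> x0; have G0 := gfun_gt0 e0 e7 x0; rewrite /f; eapply has_deriv_eq.
    apply: deriv_add; first exact: deriv_powR G0 (deriv_gfun e x).
    by apply: deriv_opp; apply: deriv_mul (deriv_cst _ _) (deriv_invc x).
  by rewrite /df /dg; field; rewrite !gt_eqF ?cosh_gt0.
have dfE x : 0 < x -> df x = (slope e t - slope e x) * (sinh x / cosh x ^+ 2).
  move=> x0; rewrite /df /dg deriv_gfunE // /slope.
  by field; rewrite !gt_eqF ?cosh_gt0 ?gfun_gt0 // ltW.
have q0 x : 0 < x -> 0 <= sinh x / cosh x ^+ 2.
  by move=> x0; rewrite divr_ge0 ?exprn_ge0 ?sinh_ge0 ?(ltW (cosh_gt0 _)) ?(ltW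
    x0).
have [tT|Tt] := leP t T.
  apply: (@nondecreasing_deriv _ f df _ _ tT).
    by move=> x /andP[tx _]; apply: Df; apply: le_trans tx; exact: ltW.
  move=> x /andP[tx _]; have x0 := lt_trans t0 tx.
  by rewrite dfE // mulr_ge0 ?q0 // subr_ge0 (slope_nonincreasing mE) // ltW.
apply: (@nonincreasing_deriv _ f df _ _ (ltW Tt)).
  by move=> x /andP[Tx _]; apply: Df; apply: le_trans Tx.
move=> x /andP[Tx xt]; have x0 := le_lt_trans T0 Tx.
by rewrite dfE // mulr_le0_ge0 ?q0 // subr_le0 (slope_nonincreasing mE) // ltW.
Qed.

(** The power of the larger eigenvalue is at most 1, so [gfun e t] is at most the power of the
    smaller eigenvalue [y], and [y] is at most 1 / cosh t. The resulting exponent 2 (1 - e)^2 of [y]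
    is at least 1. *)
Lemma gfun_powR_vanishing e t : 0 < e -> e <= 1 / 7 -> 0 < t ->
  (gfun e t `^ (1 - e)) ^+ 2 <= t^-1.
Proof.
move=> e0 e7 t0; have e1 : e < 1 by lra.
have K0 := cosh_gt0 t; have K1 := cosh_ge1 t.
pose y := expR (- t) / (2 * cosh t).
have y0 : 0 < y by rewrite divr_gt0 ?expR_gt0 ?mulr_gt0.
have E1 : expR (- t) <= 1 by rewrite expR_le1 oppr_le0 ltW.
have yk : y <= (cosh t)^-1.
  rewrite /y ler_pdivrMr ?mulr_gt0 //.
  have -> : (cosh t)^-1 * (2 * cosh t) = 2 by field; rewrite gt_eqF.
  lra.
have y1 : y <= 1 by apply: le_trans yk _; rewrite invf_le1.
have Gy : gfun e t <= y `^ (1 - e).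
  rewrite (gfunE _ e0 e1) -/y lerBlDr [leRHS]addrC lerD2r.
  rewrite [leRHS](_ : 1 = 1 `^ (1 - e)); last by rewrite powR1.
  apply: ge0_ler_powR; rewrite ?nnegrE ?divr_ge0 ?expR_ge0 ?mulr_ge0 ?(ltW K0)
    //; first lra.
  rewrite ler_pdivrMr ?mulr_gt0 // mul1r coshE.
  have := expR_ge0 (- t); lra.
have G0 := gfun_ge0 t e0 e1.
have -> : (gfun e t `^ (1 - e)) ^+ 2 = gfun e t `^ ((1 - e) * 2).
  by rewrite powRrM powR_mulrn ?powR_ge0.
apply: (@le_trans _ _ ((y `^ (1 - e)) `^ ((1 - e) * 2))).
  by apply: ge0_ler_powR; rewrite ?nnegrE ?powR_ge0 //; lra.
rewrite -powRrM; apply: (@le_trans _ _ (y `^ 1)).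
  by apply: ger_powR; rewrite ?y0 //; nra.
rewrite powRr1 ?(ltW y0) //; apply: le_trans yk _.
rewrite lef_pV2 ?posrE //; apply: (le_trans (sinh_ge (ltW t0))).
have S0 := sinh_ge0 (ltW t0).
by rewrite -(@ler_pXn2r _ 2) ?nnegrE ?(ltW K0) // cosh_sqr lerDr.
Qed.

Lemma exists_cosh x : 0 < x -> x <= 1 -> exists2 t : R, 0 <= t & x =
  (cosh t)^-1.
Proof.
move=> x0 x1; pose s := Num.sqrt (1 - x ^+ 2).
have s2 : s ^+ 2 = 1 - x ^+ 2 by rewrite sqr_sqrtr // subr_ge0 expr_le1 // ltW.
have s0 : 0 <= s := sqrtr_ge0 _.
have u0 : 0 < (1 + s) / x by rewrite divr_gt0 // ltr_pwDl.
(* The logarithmic formula for arcosh (1 / x). *)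
exists (ln ((1 + s) / x)).
  by rewrite ln_ge0 // ler_pdivlMr // mul1r; lra.
rewrite coshE expRN lnK ?posrE //.
have h : 1 + s != 0 by rewrite gt_eqF // ltr_pwDl.
have -> : (1 + s) / x + ((1 + s) / x)^-1 = 2 / x.
  rewrite invf_div; apply: (mulIf (mulf_neq0 (lt0r_neq0 x0) h)).
  transitivity (1 + 2 * s + s ^+ 2 + x ^+ 2); first by field; rewrite h gt_eqF.
  rewrite s2; transitivity (2 * (1 + s)); first by ring.
  by field; rewrite gt_eqF.
by field; rewrite gt_eqF.
Qed.

Lemma h_fun_param e t : 0 < e -> e < 1 -> 0 <= t ->
  h_fun (1 - e) (cosh t)^-1 = gfun e t `^ (1 - e).
Proof.
move=> e0 e1 t0; have K0 := cosh_gt0 t.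
rewrite /h_fun (gfunE _ e0 e1).
have -> : Num.sqrt (1 - (cosh t)^-1 ^+ 2) = sinh t / cosh t.
  have -> : 1 - (cosh t)^-1 ^+ 2 = (sinh t / cosh t) ^+ 2.
    rewrite exprMn exprVn -[in LHS](@divff _ (cosh t ^+ 2)) ?expf_neq0 ?gt_eqF //.
    by rewrite -[X in _ - X]mul1r -mulrBl cosh_sqr [1 + _]addrC addrK.
  by rewrite sqrtr_sqr ger0_norm // divr_ge0 ?sinh_ge0 // ltW.
have -> : (1 + sinh t / cosh t) / 2 = expR t / (2 * cosh t).
  have -> : expR t = cosh t + sinh t by rewrite coshE sinhE; field.
  by field; rewrite gt_eqF.
have -> // : (1 - sinh t / cosh t) / 2 = expR (- t) / (2 * cosh t).
have -> : expR (- t) = cosh t - sinh t by rewrite coshE sinhE; field.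
by field; rewrite gt_eqF.
Qed.

Lemma h_fun0 w : w != 0 -> h_fun w 0 = 0 :> R.
Proof.
move=> w0; rewrite /h_fun expr0n subr0 sqrtr1 subrr mul0r powR0 //.
by rewrite divff ?pnatr_eq0 // powR1 addr0 subrr powR0.
Qed.

Lemma h_fun_ge0 w x : 0 <= h_fun w x :> R.
Proof. exact: powR_ge0. Qed.

Lemma h_fun_support m e c : m = (14 * 1000 + 202) / 10 ^+ 5 ->
  0 < e -> e <= m -> 0 < c -> c < 1 ->
  exists2 k, 0 <= k & forall x, 0 <= x <= 1 ->
    h_fun (1 - e) c + k * (x - c) <= h_fun (1 - e) x.
Proof.
move=> mE e0 em c0 c1; have e7 : e <= 1 / 7 by rewrite mE in em; lra.
have e1 : e < 1 by lra.
have [t t0 ct] := exists_cosh c0 (ltW c1).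
have {}t0 : 0 < t.
  rewrite lt_neqAle t0 andbT; apply: contraTneq c1 => t00.
  by rewrite ct -t00 cosh0 invr1 ltxx.
exists (slope e t); first exact: slope_ge0.
move=> x /andP[x0 x1]; rewrite {1}ct h_fun_param ?(ltW t0) //.
move: x0; rewrite le_eqVlt => /orP[/eqP <-|x0]; last first.
  have [T T0 xT] := exists_cosh x0 x1.
  by rewrite xT ct h_fun_param //; exact: (support_line_param mE).
(* The point 0 corresponds to an infinite parameter and is reached as a limit of 1 / cosh T. *)
rewrite h_fun0 ?subr_eq0 ?gt_eqF // sub0r.
apply: (@le0_vanishing _ _ t) => T tT T0.
exists (gfun e T `^ (1 - e)); last exact: gfun_powR_vanishing.
apply: le_trans (support_line_param mE e0 em t0 (ltW T0)).
rewrite lerD2l ler_wpM2l ?slope_ge0 // ct lerDr invr_ge0 ltW ?cosh_gt0 //.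
Qed.

Lemma h_fun1 x : h_fun 1 x = 0 :> R.
Proof.
rewrite /h_fun; set s := Num.sqrt _.
have s0 : 0 <= s := sqrtr_ge0 _.
have s1 : s <= 1.
  rewrite -sqrtr1 ler_sqrt // lerBlDr lerDl sqr_ge0 //.
have -> : ((1 + s) / 2) `^ 1 = (1 + s) / 2 by rewrite powRr1 //; lra.
have -> : ((1 - s) / 2) `^ 1 = (1 - s) / 2 by rewrite powRr1 //; lra.
by rewrite (_ : _ - 1 = 0) ?powR0 ?oner_eq0 //; lra.
Qed.

(** The nonnegative numbers p_i (1 - x_i) have sum at most 0, so x_i = 1 wherever p_i is nonzero.
    This serves Jensen's inequality at c = 1, an endpoint that [h_fun_support] excludes. *)
Lemma weighted_sum_max k (p x : 'I_k -> R) (f : R -> R) :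
  (forall i, 0 <= p i) -> \sum_i p i = 1 -> (forall i, x i <= 1) ->
  1 <= \sum_i p i * x i -> \sum_i p i * f (x i) = f 1.
Proof.
move=> p0 p1 x1 px; rewrite -[RHS]mul1r -[X in _ = X * _]p1 mulr_suml;
  apply: eq_bigr => i _.
have px0 j : 0 <= p j * (1 - x j) by rewrite mulr_ge0 // subr_ge0.
have : \sum_j p j * (1 - x j) == 0.
  rewrite eq_le (sumr_ge0 _ (fun j _ => px0 j)) andbT.
  under eq_bigr do rewrite mulrBr mulr1.
  by rewrite sumrB p1 subr_le0.
rewrite (psumr_eq0 _ (fun j _ => px0 j)) => /allP /(_ i (mem_index_enum _)) /=.
rewrite mulf_eq0 subr_eq0 => /orP[/eqP ->|/eqP <- //].
by rewrite !mul0r.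
Qed.

(** For omega < 1 and 0 < c < 1 the support line at [c] is averaged; its slope is nonnegative, which
    matters because the average of [x] may exceed [c]. For omega = 1 or c = 0 the left-hand side is
    0. *)
Lemma h_fun_jensen m (omega : R) k (p x : 'I_k -> R) c :
  m = (14 * 1000 + 202) / 10 ^+ 5 -> 1 - m <= omega -> omega <= 1 ->
  (forall i, 0 <= p i) -> \sum_i p i = 1 -> (forall i, 0 <= x i <= 1) ->
  0 <= c <= 1 -> c <= \sum_i p i * x i ->
  h_fun omega c <= \sum_i p i * h_fun omega (x i).
Proof.
move=> mE mw w1 p0 p1 x01 /andP[c0 c1] cx.
have hs0 : 0 <= \sum_i p i * h_fun omega (x i).
  by apply: sumr_ge0 => i _; rewrite mulr_ge0 // h_fun_ge0.
move: w1; rewrite le_eqVlt => /orP[/eqP w1|w1].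
  by apply: le_trans hs0; rewrite w1 h_fun1.
have w0 : 0 < omega by rewrite mE in mw; lra.
move: c0; rewrite le_eqVlt => /orP[/eqP c0|c0].
  by rewrite -c0 h_fun0 ?gt_eqF.
move: c1; rewrite le_eqVlt => /orP[/eqP c1|c1].
  rewrite c1 (weighted_sum_max (h_fun omega) p0 p1) //; last by rewrite -c1.
  by move=> i; have /andP[] := x01 i.
have e0 : 0 < 1 - omega by lra.
have em : 1 - omega <= m by lra.
have [q q0 hq] := h_fun_support mE e0 em c0 c1.
have -> : omega = 1 - (1 - omega) by ring.
apply: (@le_trans _ _ (\sum_i p i * (h_fun (1 - (1 - omega)) c + q * (x i -
  c)))); last first.
  by apply: ler_sum => i _; rewrite ler_wpM2l // hq.
under eq_bigr do rewrite mulrDr [p _ * (q * _)]mulrCA mulrBr.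
rewrite big_split /= -mulr_suml p1 mul1r lerDl -mulr_sumr mulr_ge0 //.
by rewrite sumrB -mulr_suml p1 mul1r subr_ge0.
Qed.

End SupportLines.

(** * Takagi factorization *)

Section Takagi.
Context {C : numClosedFieldType}.
Local Notation cj A := (map_mx Num.conj A).

Lemma map_conjK m n (A : 'M[C]_(m, n)) : cj (cj A) = A.
Proof. by apply/matrixP => i j; rewrite !mxE conjCK. Qed.

Lemma mul_adj_ge0 n (v : 'rV[C]_n) : 0 <= (v *m v ^t*) 0 0.
Proof.
by rewrite mxE sumr_ge0 // => j _; rewrite !mxE mul_conjC_ge0.
Qed.

Lemma mul_adj_gt0 n (v : 'rV[C]_n) : v != 0 -> 0 < (v *m v ^t*) 0 0.
Proof.
move=> v0; rewrite lt_neqAle mul_adj_ge0 andbT eq_sym.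
apply: contra v0; rewrite mxE psumr_eq0 => [/allP H|j _]; last first.
  by rewrite !mxE mul_conjC_ge0.
apply/eqP/rowP => j; apply/eqP; rewrite mxE.
by have := H j (mem_index_enum _); rewrite /= !mxE mul_conjC_eq0.
Qed.

(* If v is an eigenvector of T * conj T with eigenvalue mu^2, then so are
   conj (v T) + mu v, if nonzero, and i v otherwise; they even satisfy the
   antilinear equation. *)
Lemma antilinear_eigenvector n (T : 'M[C]_n.+1) : T^T = T ->
  exists u : 'rV[C]_n.+1, exists mu : C,
    [/\ u != 0, 0 <= mu & u *m T = mu *: cj u].
Proof.
move=> symT; pose Tc := cj T.
have TcE : Tc = T ^t* by rewrite symT.
have [a /eigenvalueP[v va v0]] := eigenvalue_closed (T *m Tc) (ltn0Sn n).
have a0 : 0 <= a.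
  have h : a * (v *m v ^t*) 0 0 = ((v *m T) *m (v *m T) ^t*) 0 0.
    by rewrite trmx_mul map_mxM /= -TcE mulmxA -(mulmxA v) va -scalemxAl
      [RHS]mxE.
  have := mul_adj_ge0 (v *m T); rewrite -h; have := mul_adj_gt0 v0.
  by move=> h1; rewrite pmulr_lge0.
pose mu := sqrtC a.
have mu0 : 0 <= mu by rewrite sqrtC_ge0.
have mu2 : mu * mu = a by rewrite -expr2 sqrtCK.
have muc : mu^* = mu by apply/CrealP; rewrite ger0_real.
have ac : a^* = a by apply/CrealP; rewrite ger0_real.
have vcE : cj v *m Tc *m T = a *: cj v.
  have := congr1 (fun A => cj A) va.
  by rewrite mulmxA !map_mxM /= map_mxZ /= /Tc map_conjK => ->; congr (_ *: _).
pose y := cj (v *m T) + mu *: v.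
have yT : y *m T = mu *: cj y.
  rewrite /y mulmxDl map_mxM vcE map_mxD map_mxZ /= [Num.conj mu]muc scalerDr
    scalerA mu2.
  by rewrite map_mxM /= !map_conjK -scalemxAl addrC.
have [y0|y0] := eqVneq y 0; last by exists y, mu.
exists ('i *: v), mu; split=> //.
  by rewrite scaler_eq0 negb_or neq0Ci.
have : v *m T = - (mu *: cj v).
  have := congr1 (fun A => cj A) y0.
  rewrite /y map_mxD map_mxZ /= [Num.conj mu]muc map_mx0 map_conjK.
  by move/eqP; rewrite addr_eq0 => /eqP.
rewrite -scalemxAl => ->.
by rewrite map_mxZ /= conjCi scalerN !scalerA mulrN scaleNr mulrC.
Qed.

Lemma unitarymx_first_row n (u : 'rV[C]_n.+1) : u != 0 ->
  exists S : 'M[C]_n.+1, exists c : C,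
    [/\ S \is unitarymx, 0 < c & u = c *: row 0 S].
Proof.
(* All rows are [u]: Gram-Schmidt normalizes the first one and completes it to an orthonormal
   basis. *)
move=> u0; pose A : 'M[C]_n.+1 := \matrix_i u.
have rA : row 0 A = u by rewrite rowK.
exists (schmidt A); have hS := schmidt_unitarymx A (leqnn _).
have := row_schmidt_sub A 0; rewrite rA.
rewrite (eq_bigl (pred1 0)) => [|k]; last by rewrite /= leqn0.
rewrite big_pred1_eq genmxE => /sub_rVP[c uc].
exists c; split=> //.
have := form1_row_schmidt A 0; rewrite rA dotmxE uc -scalemxAl mxE.
have -> : (row 0 (schmidt A) *m (row 0 (schmidt A)) ^t*) 0 0 = 1.
  have h : (schmidt A *m (schmidt A) ^t*) 0 0 = 1
    by rewrite (unitarymxP hS) mxE eqxx.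
  by rewrite -h !mxE; apply: eq_bigr => j _; rewrite !mxE.
rewrite mulr1 => c0; rewrite lt_neqAle c0 andbT eq_sym.
by apply: contra u0 => /eqP c00; rewrite uc c00 scale0r.
Qed.

(** Deflation: in a unitary basis that starts with an antilinear eigenvector the first row becomes
    (mu, 0, ..., 0), symmetry clears the first column, and induction applies to the remaining
    block. *)
Lemma takagi n (T : 'M[C]_n) : T^T = T ->
  exists Q : 'M[C]_n, exists l : 'rV[C]_n,
    [/\ Q \is unitarymx, forall j, 0 <= l 0 j & Q *m T *m Q^T = diag_mx l].
Proof.
elim: n T => [|n IHn] T symT.
  exists 1%:M, 0; split; first by apply/unitarymxP;
    rewrite trmx1 map_mx1 mulmx1.
    by move=> j; rewrite mxE.
  by apply/matrixP => -[].
have [u [mu [u0 mu0 uT]]] := antilinear_eigenvector symT.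
have [S [c [hS c0 uS]]] := unitarymx_first_row u0.
have cn : c != 0 by rewrite gt_eqF.
have cc : c^* = c by apply/CrealP; rewrite gtr0_real.
pose r := row 0 S.
have rT : r *m T = mu *: cj r.
  apply: (scalerI cn); rewrite scalemxAl -uS uT uS map_mxZ /= cc.
  by rewrite !scalerA mulrC.
have [T1 T1E] : exists T1 : 'M[C]_(1 + n), T1 = S *m T *m S^T
  by exists (S *m T *m S^T).
have symT1 : T1^T = T1 by rewrite T1E !trmx_mul trmxK symT mulmxA.
have row0 j : T1 0 j = mu *+ (j == 0).
  have -> : T1 0 j = (row 0 T1) 0 j by rewrite [RHS]mxE.
  rewrite T1E -mulmxA row_mul mulmxA -/r rT -scalemxAl.
  have -> : cj r *m S^T = row 0 (cj (S *m S ^t*)).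
    by rewrite map_mxM map_conjK row_mul map_row.
  by rewrite (unitarymxP hS) map_mx1 !mxE mulr_natr eq_sym.
have E : T1 = block_mx (mu%:M : 'M[C]_1) 0 0 (drsubmx T1).
  rewrite -[LHS]submxK; congr block_mx; apply/matrixP => i j.
  - by rewrite [LHS]mxE [LHS]mxE !mxE !ord1 lshift0 row0.
  - by rewrite !mxE !ord1 lshift0 row0.
  - by rewrite -symT1 !mxE !ord1 lshift0 row0.
have symD : (drsubmx T1)^T = drsubmx T1 by rewrite trmx_drsub symT1.
have [Q [l [hQ l0 Ql]]] := IHn _ symD.
pose Q1 : 'M[C]_(1 + n) := block_mx 1%:M 0 0 Q.
have hQ1 : Q1 \is unitarymx.
  apply/unitarymxP; rewrite tr_block_mx map_block_mx mulmx_block.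
  rewrite !trmx1 !map_mx1 !trmx0 !map_mx0 !mulmx0 !mul0mx !mul1mx !addr0 add0r.
  by rewrite (unitarymxP hQ) -scalar_mx_block.
exists (Q1 *m S), (row_mx (mu%:M : 'M[C]_1) l); split.
- exact: mul_unitarymx.
- by move=> j; rewrite mxE; case: splitP => k _; rewrite ?l0 // mxE !ord1 eqxx.
- rewrite trmx_mul mulmxA -(mulmxA Q1) -(mulmxA Q1) -T1E.
  have QT : Q1^T = block_mx 1%:M 0 0 Q^T
    by rewrite /Q1 tr_block_mx trmx1 !trmx0.
  suff : Q1 *m T1 *m Q1^T = diag_mx (row_mx (mu%:M : 'M[C]_1) l) by [].
  rewrite QT E /Q1 !mulmx_block.
  rewrite !(mulmx0, mul0mx, mul1mx, mulmx1, addr0, add0r) Ql.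
  by rewrite diag_mx_row; congr block_mx; apply/matrixP => i j;
    rewrite !mxE !ord1.
Qed.

End Takagi.

(** * Optimal decompositions *)

Section ZeroDiagonal.
Context {F : rcfType}.

Definition qform n (A : 'M[F]_n) (x : 'rV[F]_n) : F := (x *m A *m x^T) 0 0.

(** On x + t y the form is a quadratic polynomial in t, with positive discriminant by the opposite
    signs; a root is then normalized. *)
Lemma qform_rotation n (A : 'M[F]_n) (x y : 'rV[F]_n) : 0 < qform A x ->
  qform A y < 0 ->
  exists c : F, exists s : F, c ^+ 2 + s ^+ 2 =
    1 /\ qform A (c *: x + s *: y) = 0.
Proof.
move=> qx qy; pose B := (x *m A *m y^T) 0 0 + (y *m A *m x^T) 0 0.
pose D := Num.sqrt (B ^+ 2 - 4 * qform A x * qform A y).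
have D2 : D ^+ 2 = B ^+ 2 - 4 * qform A x * qform A y.
  by rewrite sqr_sqrtr // subr_ge0; nra.
pose t := (D - B) / (2 * qform A y).
have qyn : qform A y != 0 by rewrite lt_eqF.
have tE : qform A x + t * B + t ^+ 2 * qform A y = 0.
  apply: (mulfI (x := 4 * qform A y)); first by rewrite mulf_neq0 ?pnatr_eq0.
  rewrite mulr0; transitivity (D ^+ 2 - (B ^+ 2 - 4 * qform A x * qform A y)).
    by rewrite /t; field.
  by rewrite D2 subrr.
have r0 : 0 < 1 + t ^+ 2 by rewrite ltr_pwDl // sqr_ge0.
pose c := (Num.sqrt (1 + t ^+ 2))^-1.
have c2 : c ^+ 2 * (1 + t ^+ 2) = 1.
  by rewrite /c exprVn sqr_sqrtr ?(ltW r0) // mulVf // gt_eqF.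
exists c, (t * c); split; first by rewrite -c2; ring.
have -> : qform A (c *: x + (t * c) *: y) =
    c ^+ 2 * (qform A x + t * B + t ^+ 2 * qform A y).
  rewrite /qform /B linearD /= !linearZ /= !mulmxDl !mulmxDr -!scalemxAl
    -!scalemxAr.
  by rewrite !mxE; ring.
by rewrite tE mulr0.
Qed.

(** As the diagonal values sum to 0, a positive one comes with a negative one. Rotating these two
    rows makes one value 0, and the other was nonzero already, so the number of nonzero values
    drops. *)
Lemma zero_diagonal n (A : 'M[F]_n) : \tr A = 0 ->
  exists Om : 'M[F]_n, Om^T *m Om = 1%:M /\ forall i, (Om *m A *m Om^T) i i = 0.
Proof.
move=> trA.
have main m (x : 'I_n -> 'rV[F]_n) : \sum_k (x k)^T *m x k = 1%:M ->
    (#|[set k | (qform A (x k) != 0)%R]%SET| <= m)%N ->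
    exists2 y : 'I_n -> 'rV[F]_n, \sum_k (y k)^T *m y k = 1%:M & forall k,
      qform A (y k) = 0.
  elim: m x => [|m IHm] x hx.
    rewrite leqn0 cards_eq0 => /eqP h0; exists x => // k; apply/eqP/negbNE.
    by have /finset.setP/(_ k) := h0; rewrite !inE => ->.
  move=> hm; have sum0 : \sum_k qform A (x k) = 0.
    transitivity (\tr (A *m \sum_k (x k)^T *m x k)); last by rewrite hx mulmx1.
    rewrite mulmx_sumr raddf_sum; apply: eq_bigr => k _.
    by rewrite /= mulmxA mxtrace_mulC mulmxA /mxtrace big_ord1.
  have [/existsP[i qi]|/existsPn all_le0] := boolP [exists i,
    0 < qform A (x i)]; last first.
    exists x => // k; apply/eqP; rewrite -oppr_eq0.
    have : \sum_k - qform A (x k) == 0 by rewrite sumrN sum0 oppr0.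
    rewrite psumr_eq0 => [/allP/(_ k (mem_index_enum _)) //|j _].
    by rewrite oppr_ge0 leNgt all_le0.
  have [/existsP[j qj]|/existsPn all_ge0] := boolP [exists j,
    qform A (x j) < 0]; last first.
    have : \sum_k qform A (x k) == 0 by rewrite sum0.
    rewrite psumr_eq0 => [/allP/(_ i (mem_index_enum _)) /=|j _];
      last by rewrite leNgt all_ge0.
    by rewrite gt_eqF.
  have [c [s [cs1 qcs]]] := qform_rotation qi qj.
  have ji : j != i by apply: contraTneq qj => ->; rewrite -leNgt ltW.
  pose y k := if k == i then c *: x i + s *: x j
              else if k == j then - s *: x i + c *: x j else x k.
  apply: (IHm y).
    rewrite -hx [LHS](bigD1 i) //= [RHS](bigD1 i) //=.
    rewrite [X in _ + X = _](bigD1 j) //= [X in _ = _ + X](bigD1 j) //= !addrA.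
    congr (_ + _); last first.
      by apply: eq_bigr => k /andP[ki kj]; rewrite /y (negPf ki) (negPf kj).
    rewrite /y !eqxx (negPf ji); apply/matrixP => a b;
      rewrite !mxE !big_ord1 !mxE.
    rewrite -[RHS]mul1r -cs1; ring.
  rewrite -ltnS; apply: leq_trans hm; apply: proper_card; apply/properP; split.
    apply/fintype.subsetP => k; rewrite !inE /y.
    have [_|ki] := eqVneq k i; first by rewrite qcs eqxx.
    by have [-> _|//] := eqVneq k j; rewrite lt_eqF.
  exists i; first by rewrite !inE gt_eqF.
  by rewrite !inE /y eqxx qcs negbK.
have [||y hy qy] := main n (fun k => delta_mx 0 k).
- apply/matrixP => a b; rewrite summxE (bigD1 a) //= big1 => [|k ka].
    by rewrite trmx_delta mul_delta_mx addr0 !mxE eqxx eq_sym.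
  by rewrite trmx_delta mul_delta_mx mxE eq_sym (negPf ka).
- by rewrite -[leqRHS]card_ord max_card.
exists (\matrix_k y k); split.
  rewrite -hy; apply/matrixP => a b; rewrite summxE mxE; apply: eq_bigr => k _.
  by rewrite !mxE big_ord1 !mxE.
move=> i; rewrite -(qy i) /qform -[in RHS](rowK y i); set Om := \matrix_k _.
by rewrite -row_mul tr_row !mxE; apply: eq_bigr => k _; rewrite !mxE.
Qed.

End ZeroDiagonal.

(** * Quadrilaterals with prescribed sides *)

Section Polygon.
Context {F : rcfType}.
Implicit Types a b s : F.

(** The directions of two sides of a triangle whose third side is (s, 0); [x1] comes from the law of
    cosines. *)
Lemma triangle a b s : 0 <= a -> 0 <= b -> a - b <= s -> b - a <= s -> s <=
  a + b ->
  exists x1 : F, exists y1 : F, exists x2 : F, exists y2 : F,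
    [/\ x1 ^+ 2 + y1 ^+ 2 = 1, x2 ^+ 2 + y2 ^+ 2 = 1,
        a * x1 + b * x2 = s & a * y1 + b * y2 = 0].
Proof.
move=> a0 b0 abs bas sab.
have [a00|an] := eqVneq a 0.
  by exists 1, 0, 1, 0; split; [ring | ring | lra | ring].
have [b00|bn] := eqVneq b 0.
  by exists 1, 0, 1, 0; split; [ring | ring | lra | ring].
have [s00|sn] := eqVneq s 0.
  by exists 1, 0, (-1), 0; split; [ring | ring | lra | ring].
have {}a0 : 0 < a by rewrite lt_neqAle eq_sym an.
have {}b0 : 0 < b by rewrite lt_neqAle eq_sym bn.
have s0 : 0 < s by rewrite lt_neqAle eq_sym sn; lra.
pose x1 := (a ^+ 2 + s ^+ 2 - b ^+ 2) / (2 * a * s).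
have as0 : 0 < 2 * a * s by rewrite !mulr_gt0.
have x11 : x1 ^+ 2 <= 1.
  rewrite exprMn exprVn ler_pdivrMr ?exprn_gt0 // mul1r -subr_ge0.
  have -> : (2 * a * s) ^+ 2 - (a ^+ 2 + s ^+ 2 - b ^+ 2) ^+ 2 =
    (a + s - b) * (a + s + b) * ((b + a - s) * (b + s - a)) by ring.
  by rewrite !mulr_ge0 //; lra.
pose y1 := Num.sqrt (1 - x1 ^+ 2).
have y12 : y1 ^+ 2 = 1 - x1 ^+ 2 by rewrite sqr_sqrtr // subr_ge0.
exists x1, y1, ((s - a * x1) / b), (- (a * y1) / b); split.
- by rewrite y12; ring.
- have -> : ((s - a * x1) / b) ^+ 2 + (- (a * y1) / b) ^+ 2 =
    (s ^+ 2 - 2 * a * s * x1 + a ^+ 2 * (x1 ^+ 2 + y1 ^+ 2)) / b ^+ 2 by field.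
  by rewrite y12 /x1; field; rewrite an bn sn.
- by field.
- by field.
Qed.

Lemma polygon (l : 'I_4 -> F) : (forall j, 0 <= l j) ->
  (forall j, 2 * l j <= \sum_k l k) ->
  exists x : 'I_4 -> F, exists y : 'I_4 -> F,
    [/\ forall k, x k ^+ 2 + y k ^+ 2 = 1, \sum_k l k * x k =
      0 & \sum_k l k * y k = 0].
Proof.
move=> l0 lsum.
have sumE (f : 'I_4 -> F) : \sum_k f k =
  f (inord 0) + f (inord 1) + f (inord 2) + f (inord 3).
  rewrite !big_ord_recl big_ord0 addr0 !addrA.
  by do !congr (_ + _); congr f; apply: val_inj; rewrite /= inordK.
rewrite sumE in lsum.
have := l0 (inord 0); have := l0 (inord 1); have := l0 (inord 2);
  have := l0 (inord 3).
have := lsum (inord 0); have := lsum (inord 1); have := lsum (inord 2);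
  have := lsum (inord 3).
set a := l (inord 0); set b := l (inord 1); set c := l (inord 2);
  set d := l (inord 3).
move=> hd hc hb ha d0 c0 b0 a0.
(* A diagonal cuts the quadrilateral into two triangles; this is the shortest length that both
   allow. The second triangle is reversed to close the figure. *)
pose s := Num.max (Num.max (a - b) (b - a)) (Num.max (c - d) (d - c)).
have [s1 s2 s3 s4] : [/\ a - b <= s, b - a <= s, c - d <= s & d - c <= s].
  by rewrite /s !le_max !lexx !orbT.
have [s5 s6] : s <= a + b /\ s <= c + d.
  by split; rewrite /s !ge_max; apply/andP; split; apply/andP; split; lra.
have [xa [ya [xb [yb [ea eb h1 h2]]]]] := triangle a0 b0 s1 s2 s5.
have [xc [yc [xd [yd [ec ed h3 h4]]]]] := triangle c0 d0 s3 s4 s6.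
exists (fun k => nth 0 [:: xa; xb; - xc; - xd] k), (fun k => nth 0 [:: ya; yb;
  - yc; - yd] k).
split.
- by case=> -[|[|[|[|k]]]] hk //=; rewrite !sqrrN.
- by rewrite sumE !inordK //= -/a -/b -/c -/d; lra.
- by rewrite sumE !inordK //= -/a -/b -/c -/d; lra.
Qed.

End Polygon.

(** * Takagi vectors of a state and the lower bound *)

Section TakagiBasis.
Context {C : numClosedFieldType}.
Local Notation cj A := (map_mx Num.conj A).

Lemma adjM m n p (A : 'M[C]_(m, n)) (B : 'M[C]_(n, p)) : (A *m B) ^t* =
  B ^t* *m A ^t*.
Proof. by rewrite trmx_mul map_mxM. Qed.

Lemma adj_diag n (d : 'rV[C]_n) : (diag_mx d) ^t* = diag_mx (cj d).
Proof. by rewrite tr_diag_mx map_diag_mx. Qed.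

Lemma mulmx_adj_eq0 m n (A : 'M[C]_(m, n)) : A *m A ^t* = 0 -> A = 0.
Proof.
move=> /matrixP h; apply/row_matrixP => i; rewrite row0.
apply/eqP/negPn/negP => /mul_adj_gt0.
have -> : (row i A *m (row i A) ^t*) 0 0 = (A *m A ^t*) i i.
  by rewrite !mxE; apply: eq_bigr => j _; rewrite !mxE.
by rewrite h mxE ltxx.
Qed.

Lemma adj_unitarymx n (U : 'M[C]_n) : U \is unitarymx -> U ^t* *m U = 1%:M.
Proof. by move=> hU; apply: mulmx1C; exact/unitarymxP. Qed.

Definition psdmx n (A : 'M[C]_n) :=
  A \is hermsymmx /\ forall v : 'cV[C]_n, 0 <= (v ^t* *m A *m v) 0 0.

(* V is an unnormalized eigendecomposition of rho and L its pseudo-inverse. *)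
Lemma psd_factor n (rho : 'M[C]_n) : psdmx rho ->
  exists V : 'M[C]_n, exists L : 'M[C]_n, exists P : 'M[C]_n,
    [/\ V *m V ^t* = rho, L *m rho *m L ^t* = P, V *m P = V
      & forall k (W : 'M[C]_(n, k)), W *m W ^t* = rho -> V *m (L *m W) = W].
Proof.
move=> [herm psd]; pose U := spectralmx rho; pose D := spectral_diag rho.
have hU : U \is unitarymx := spectral_unitarymx rho.
have UU := unitarymxP hU; have UU' := adj_unitarymx hU.
have rhoE : rho = U ^t* *m diag_mx D *m U.
  by rewrite -invmx_unitary //; apply/orthomx_spectralP/hermitian_normalmx.
have DE : diag_mx D = U *m rho *m U ^t*.
  by rewrite rhoE !mulmxA UU mul1mx -mulmxA UU mulmx1.
have D0 j : 0 <= D 0 j.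
  have -> : D 0 j = (diag_mx D) j j by rewrite mxE eqxx.
  have := psd ((row j U) ^t*); rewrite trmxCK DE.
  congr (0 <= _); rewrite -row_mul.
  rewrite !mxE; apply: eq_bigr => k _; congr (_ * _); rewrite !mxE //.
pose r : 'rV[C]_n := \row_j sqrtC (D 0 j).
have rc : cj r = r.
  by apply/rowP => j; rewrite !mxE; apply/CrealP;
    rewrite ger0_real // sqrtC_ge0.
(* Since the inverse of 0 is 0, this vanishes on the kernel of [rho]. *)
pose ri : 'rV[C]_n := \row_j (sqrtC (D 0 j))^-1.
have ric : cj ri = ri.
  by apply/rowP => j; rewrite !mxE; apply/CrealP;
    rewrite ger0_real // invr_ge0 sqrtC_ge0.
pose p : 'rV[C]_n := \row_j (D 0 j != 0)%:R.
have diagE (a b c : 'rV[C]_n) : (forall j, a 0 j * b 0 j = c 0 j) ->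
    diag_mx a *m diag_mx b = diag_mx c.
  by move=> h; rewrite mulmx_diag; congr diag_mx; apply/rowP => j;
    rewrite mxE h.
have rr : diag_mx r *m diag_mx r = diag_mx D.
  by apply: diagE => j; rewrite !mxE -expr2 sqrtCK.
have rri : diag_mx r *m diag_mx ri = diag_mx p.
  apply: diagE => j; rewrite !mxE; have [->|Dj] := eqVneq (D 0 j) 0.
    by rewrite sqrtC0 mul0r.
  by rewrite mulfV // sqrtC_eq0.
have rir : diag_mx ri *m diag_mx r = diag_mx p by rewrite -rri !mulmx_diag;
  congr diag_mx; apply/rowP => j; rewrite !mxE mulrC.
have rp : diag_mx r *m diag_mx p = diag_mx r.
  apply: diagE => j; rewrite !mxE; have [->|Dj] := eqVneq (D 0 j) 0.
    by rewrite sqrtC0 mul0r.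
  by rewrite mulr1.
have pp : diag_mx p *m diag_mx p = diag_mx p.
  by apply: diagE => j; rewrite !mxE -natrM mulnb andbb.
have pD : diag_mx p *m diag_mx D = diag_mx D.
  apply: diagE => j; rewrite !mxE; have [->|Dj] := eqVneq (D 0 j) 0.
    by rewrite mulr0.
  by rewrite mul1r.
exists (U ^t* *m diag_mx r), (diag_mx ri *m U), (diag_mx p); split.
- by rewrite adjM trmxCK adj_diag rc mulmxA -(mulmxA (U ^t*)) rr.
- rewrite adjM adj_diag ric rhoE -rr !mulmxA -(mulmxA (diag_mx ri) U) UU mulmx1.
  by rewrite -(mulmxA _ U) UU mulmx1 rir -mulmxA rri pp.
- by rewrite -mulmxA rp.
move=> k W WW.
have VL : U ^t* *m diag_mx r *m (diag_mx ri *m U) = U ^t* *m diag_mx p *m U.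
  by rewrite mulmxA -(mulmxA (U ^t*)) rri.
(* [E] projects onto the range of [rho]; as [1%:M - E] annihilates [rho], it annihilates every
   factor [W]. *)
rewrite mulmxA VL; set E := _ *m U.
have Erho : (1%:M - E) *m rho = 0.
  rewrite mulmxBl mul1mx {2}rhoE /E !mulmxA -(mulmxA _ U) UU mulmx1.
  by rewrite -(mulmxA (U ^t*)) pD -rhoE subrr.
have : (1%:M - E) *m W = 0.
  by apply: mulmx_adj_eq0; rewrite adjM !mulmxA -(mulmxA _ W) WW Erho mul0mx.
by rewrite mulmxBl mul1mx => /eqP; rewrite subr_eq0 => /eqP <-.
Qed.

(** The Takagi unitary of the congruence of [S] by the factor from [psd_factor] rotates that factor.
    For singular [rho] the matrix in the fourth clause is only a projector; the clause gives unit
    norm to the coefficient rows with nonzero [l 0 j]. *)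
Lemma takagi_factor n (rho S : 'M[C]_n) : psdmx rho -> S^T = S ->
  exists V : 'M[C]_n, exists L : 'M[C]_n, exists l : 'rV[C]_n,
    [/\ V *m V ^t* = rho, forall j, 0 <= l 0 j, V^T *m S *m V = diag_mx l,
      diag_mx l *m (L *m rho *m L ^t*) = diag_mx l
      & forall k (W : 'M[C]_(n, k)), W *m W ^t* = rho -> V *m (L *m W) = W].
Proof.
move=> psd symS; have [V [L [P [VV LL VP VLW]]]] := psd_factor psd.
have symT : (V^T *m S *m V)^T = V^T *m S *m V
  by rewrite !trmx_mul trmxK symS mulmxA.
have [Q [l [hQ l0 Ql]]] := takagi symT.
have QQ : Q^T *m cj Q = 1%:M.
  have := congr1 trmx (adj_unitarymx hQ).
  by rewrite trmx_mul trmx1 map_trmx trmxK.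
exists (V *m Q^T), (cj Q *m L), l; split=> //.
- rewrite adjM trmxK mulmxA -(mulmxA V) QQ mulmx1 //.
- by rewrite trmx_mul trmxK !mulmxA in Ql *.
- rewrite adjM -[(cj Q) ^t*]trmxK.
  have -> : (cj Q) ^t* ^T = Q by rewrite map_trmx trmxK map_conjK.
  rewrite -Ql.
  have -> : Q *m (V^T *m S *m V) *m Q^T *m (cj Q *m L *m rho *m (L ^t* *m Q^T))
    =
    Q *m V^T *m S *m V *m (Q^T *m cj Q) *m (L *m rho *m L ^t*) *m Q^T
      by rewrite !mulmxA.
  by rewrite QQ mulmx1 LL -(mulmxA _ V) VP !mulmxA.
- move=> k W WW.
  have -> : V *m Q^T *m (cj Q *m L *m W) = V *m (Q^T *m cj Q) *m (L *m W)
    by rewrite !mulmxA.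
  by rewrite QQ mulmx1 VLW.
Qed.

(** With A = L W the i-th diagonal entry is the sum of the l_j A_ji^2. The triangle inequality
    isolates [j0]; summation over i uses that row j of A has norm 1 if l_j is nonzero. *)
Lemma preconcurrence_lb n k (rho S V L : 'M[C]_n) (l : 'rV[C]_n)
    (W : 'M[C]_(n, k)) (j0 : 'I_n) :
  (forall j, 0 <= l 0 j) -> V^T *m S *m V = diag_mx l ->
  diag_mx l *m (L *m rho *m L ^t*) = diag_mx l ->
  W *m W ^t* = rho -> V *m (L *m W) = W ->
  l 0 j0 *+ 2 - \sum_j l 0 j <= \sum_i `|(W^T *m S *m W) i i|.
Proof.
move=> l0 VS lP WW VLW; pose A := L *m W.
have AA : A *m A ^t* = L *m rho *m L ^t* by rewrite adjM -WW !mulmxA.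
have norm1 j : l 0 j * \sum_i `|A j i| ^+ 2 = l 0 j.
  have : (diag_mx l *m (A *m A ^t*)) j j = l 0 j by rewrite AA lP mxE eqxx.
  rewrite mul_diag_mx mxE mxE => {2}<-; congr (_ * _).
  by apply: eq_bigr => i _; rewrite !mxE normCK.
have qE i : (W^T *m S *m W) i i = \sum_j l 0 j * A j i ^+ 2.
  rewrite -VLW -/A trmx_mul -!mulmxA (mulmxA V^T) (mulmxA _ V) VS mxE.
  by apply: eq_bigr => j _; rewrite mul_diag_mx !mxE mulrCA expr2.
apply: (@le_trans _ _ (\sum_i (l 0 j0 * `|A j0 i| ^+ 2 *+ 2 - \sum_j l 0 j *
  `|A j i| ^+ 2))).
  rewrite sumrB exchange_big /= sumrMnl -mulr_sumr norm1 lerD2l lerN2.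
  by apply: ler_sum => j _; rewrite -mulr_sumr norm1.
apply: ler_sum => i _; rewrite qE (bigD1 j0) //= [in leRHS](bigD1 j0) //=.
rewrite opprD addrA mulr2n addrK.
apply: le_trans (lerB_normD _ _);
  rewrite normrM normrX (ger0_norm (l0 _)) lerD2l lerN2.
apply: le_trans (ler_norm_sum _ _ _) _; apply: ler_sum => j _.
by rewrite normrM normrX (ger0_norm (l0 _)).
Qed.

End TakagiBasis.

(** * Attaining the bound *)

Section OptimalDecomposition.
Context {R : rcfType}.
Local Notation C := R[i].
Local Notation cj A := (map_mx Num.conj A).
Local Notation rm A := (map_mx (real_complex R) A).

Lemma conj_real (x : R) : Num.conj x%:C = x%:C.
Proof. by apply/CrealP/complex_realP; exists x. Qed.

Lemma adj_rm m n (A : 'M[R]_(m, n)) : (rm A) ^t* = rm A^T.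
Proof. by apply/matrixP => i j; rewrite !mxE conj_real. Qed.

Lemma mix_decomposition n (rho V : 'M[C]_n) (z : 'rV[C]_n) (Om : 'M[R]_n) :
  V *m V ^t* = rho -> (forall j, `|z 0 j| = 1) -> Om^T *m Om = 1%:M ->
  (V *m diag_mx z *m rm Om^T) *m (V *m diag_mx z *m rm Om^T) ^t* = rho.
Proof.
move=> VV z1 OO; rewrite !adjM adj_rm trmxK.
have OO' : rm Om^T *m rm Om = 1%:M by rewrite -map_mxM OO map_mx1.
transitivity (V *m (diag_mx z *m (rm Om^T *m rm Om) *m (diag_mx z) ^t*) *m V
  ^t*).
  by rewrite !mulmxA.
rewrite OO' mulmx1 adj_diag mulmx_diag.
have -> : diag_mx (\row_j (z 0 j * (cj z) 0 j)) = 1%:M.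
  by rewrite -diag_const_mx; congr diag_mx; apply/rowP => j;
    rewrite !mxE -normCK z1 expr1n.
by rewrite mulmx1.
Qed.

Lemma mix_preconcurrence n (S V : 'M[C]_n) (l z : 'rV[C]_n) (Om : 'M[R]_n) i :
  V^T *m S *m V = diag_mx l ->
  ((V *m diag_mx z *m rm Om^T)^T *m S *m (V *m diag_mx z *m rm Om^T)) i i =
  \sum_j (Om i j)%:C ^+ 2 * (l 0 j * z 0 j ^+ 2).
Proof.
move=> VS; rewrite !trmx_mul tr_diag_mx map_trmx trmxK.
have -> : rm Om *m (diag_mx z *m V^T) *m S *m (V *m diag_mx z *m rm Om^T) =
  rm Om *m (diag_mx z *m (V^T *m S *m V) *m diag_mx z) *m rm Om^T
    by rewrite !mulmxA.
rewrite VS !mulmx_diag mxE; apply: eq_bigr => j _.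
by rewrite mul_mx_diag !mxE; ring.
Qed.

Lemma hadamard4 : exists Om : 'M[R]_4, Om^T *m Om = 1%:M /\ forall i j,
  Om i j ^+ 2 = 1 / 4.
Proof.
pose H : seq (seq R) := [:: [:: 1; 1; 1; 1]; [:: 1; -1; 1; -1]; [:: 1; 1; -1;
  -1]; [:: 1; -1; -1; 1]].
exists (\matrix_(i < 4, j < 4) (nth 0 (nth [::] H i) j / 2)); split.
  apply/matrixP => -[[|[|[|[|i]]]] hi] -[[|[|[|[|j]]]] hj] //;
  by rewrite !mxE !big_ord_recl big_ord0 !mxE /=; field.
by move=> -[[|[|[|[|i]]]] hi] -[[|[|[|[|j]]]] hj] //; rewrite !mxE /=; field.
Qed.

Lemma optimal_decomposition (rho S V : 'M[C]_4) (l : 'I_4 -> R) :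
  \tr rho = 1 -> V *m V ^t* = rho -> (forall j, 0 <= l j) ->
  V^T *m S *m V = diag_mx (\row_j (l j)%:C) ->
  exists c : R, exists W : 'M[C]_4,
    [/\ 0 <= c, c = 0 \/ exists j0, c = l j0 *+ 2 - \sum_j l j, W *m W ^t* = rho
      & forall i, `|(W^T *m S *m W) i i| = c%:C * (W ^t* *m W) i i].
Proof.
move=> trrho VV l0 VS.
have [/existsP[j0 hj0]|/existsPn hall] := boolP [exists j, \sum_k l k <=
  l j *+ 2].
- pose c := l j0 *+ 2 - \sum_j l j; have c0 : 0 <= c by rewrite subr_ge0.
  (* The squares of the phases [z]; with these signs the numbers l_j add up to [c]. *)
  pose sg j : R := if j == j0 then 1 else -1.
  pose z : 'rV[C]_4 := \row_j (if j == j0 then 1 else 'i).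
  have z1 j : `|z 0 j| = 1 by rewrite mxE; case: ifP; rewrite ?normr1 // normCi.
  have z2 j : z 0 j ^+ 2 = (sg j)%:C.
    by rewrite mxE /sg; case: ifP => _;
      rewrite ?expr1n // sqrCi rmorphN rmorph1.
  pose Y := V *m diag_mx z.
  (* For real [Om] only the real part of the Gram matrix contributes to the diagonal. Once [Om]
     makes the diagonal of [T] zero, each diagonal entry of the form is [c] times a squared norm. *)
  pose G : 'M[R]_4 := map_mx (@complex.Re R) (Y ^t* *m Y).
  pose T : 'M[R]_4 := diag_mx (\row_j (l j * sg j)) - c *: G.
  have YY : Y *m Y ^t* = rho.
    have OO : (1%:M : 'M[R]_4)^T *m 1%:M = 1%:M by rewrite trmx1 mulmx1.
    by have := mix_decomposition VV z1 OO; rewrite trmx1 map_mx1 mulmx1.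
  have trG : \tr G = 1.
    transitivity (complex.Re (\tr (Y ^t* *m Y))).
      rewrite /mxtrace raddf_sum; apply: eq_bigr => j _.
      by rewrite mxE.
    by rewrite mxtrace_mulC YY trrho.
  have trT : \tr T = 0.
    rewrite linearB /= linearZ /= trG mxtrace_diag mulr1 /c (bigD1 j0) //= [in
      X in _ - X](bigD1 j0) //=.
    rewrite !mxE /sg eqxx mulr1.
    rewrite (eq_bigr (fun j => - l j)) => [|j jj];
      last by rewrite mxE (negPf jj) mulrN1.
    by rewrite sumrN; lra.
  have [Om [OO OT]] := zero_diagonal trT.
  exists c, (Y *m rm Om^T); split=> //.
  + by right; exists j0.
  + exact: mix_decomposition.
  + move=> i; rewrite {1 2}/Y (mix_preconcurrence _ _ _ VS).
    set N := (_ ^t* *m _) i i.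
    have N0 : 0 <= N.
      rewrite /N mxE sumr_ge0 // => k _; rewrite !mxE mulrC mul_conjC_ge0 //.
    have NE : N = ((Om *m G *m Om^T) i i)%:C.
      have -> : (Om *m G *m Om^T) i i = complex.Re N.
        rewrite /N adjM adj_rm trmxK.
        rewrite mulmxA -(mulmxA (rm Om)) !mxE raddf_sum; apply: eq_bigr => j _.
        rewrite !mxE mulr_suml mulr_suml raddf_sum; apply: eq_bigr => k _.
        rewrite [in RHS]mxE /G [map_mx _ _ _ _]mxE.
        by case: ((Y ^t* *m Y) k j) => a b /=;
          rewrite !(mulr0, mul0r, subr0, addr0).
      by rewrite RRe_real // ger0_real.
    have E : \sum_j (Om i j)%:C ^+ 2 * ((\row_j0 (l j0)%:C) 0 j * z 0 j ^+ 2) =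
      c%:C * N.
      rewrite NE -rmorphM /=.
      transitivity (((Om *m diag_mx (\row_j (l j * sg j)) *m Om^T) i i)%:C).
        rewrite mxE rmorph_sum; apply: eq_bigr => j _.
        by rewrite z2 mul_mx_diag !mxE -rmorphXn -!rmorphM; congr (_%:C); ring.
      congr (_%:C); apply/eqP; rewrite -subr_eq0; apply/eqP.
      rewrite -[RHS](OT i) /T mulmxBr mulmxBl -scalemxAr -scalemxAl.
      by rewrite [in RHS]mxE; congr (_ + _); rewrite !mxE.
    by rewrite E ger0_norm // mulr_ge0 // ler0c.
- have hl j : 2 * l j <= \sum_k l k by rewrite ltW // mulr_natl ltNge hall.
  have [x [y [xy sx sy]]] := polygon l0 hl.
  pose u j : C := x j +i* y j.
  have u1 j : `|u j| = 1 by rewrite normc_def /= xy sqrtr1.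
  (* Square roots, because the phases enter the form squared. *)
  pose z : 'rV[C]_4 := \row_j sqrtC (u j).
  have z1 j : `|z 0 j| = 1.
    apply/eqP; rewrite -(@eqrXn2 _ 2) // expr1n -normrX mxE sqrtCK u1 //.
  have [Om [OO O4]] := hadamard4.
  exists 0, (V *m diag_mx z *m rm Om^T); split=> //; first by left.
  + exact: mix_decomposition.
  + move=> i; rewrite (mix_preconcurrence _ _ _ VS) mul0r.
    suff -> : \sum_j (Om i j)%:C ^+ 2 * ((\row_j0 (l j0)%:C) 0 j * z 0 j ^+ 2)
      = 0 by rewrite normr0.
    transitivity ((1 / 4)%:C * \sum_j (l j)%:C * u j).
      rewrite mulr_sumr; apply: eq_bigr => j _.
      by rewrite !mxE sqrtCK -rmorphXn /= O4.
    have -> : \sum_j (l j)%:C * u j = (\sum_j l j * x j) +i* (\sum_j l j * y j).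
      apply/eqP; rewrite eq_complex /= !raddf_sum; apply/andP; split;
        apply/eqP/eq_bigr => j _ /=;
      by rewrite !(mul0r, subr0, addr0).
    by rewrite sx sy mulr0.
Qed.

End OptimalDecomposition.

(** * Two-qubit states *)

Section TwoQubits.
Context {R : realType}.
Local Notation C := R[i].
Implicit Types phi : 'cV[C]_(2 * 2).

Definition coef_mx phi : 'M[C]_2 := \matrix_(i, j) phi (mxvec_index i j) 0.

(** The negative of the tensor square of the Pauli matrix sigma_y. *)
Definition spinflip_mx : 'M[C]_(2 * 2) :=
  delta_mx (mxvec_index 0 0) (mxvec_index 1 1) + delta_mx (mxvec_index 1 1)
    (mxvec_index 0 0)
  - delta_mx (mxvec_index 0 1) (mxvec_index 1 0) - delta_mx (mxvec_index 1 0)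
    (mxvec_index 0 1).

Lemma tr_spinflip_mx : spinflip_mx^T = spinflip_mx.
Proof.
rewrite /spinflip_mx !linearB /= !linearD /= !trmx_delta.
by rewrite [delta_mx (mxvec_index 1 1) _ + _]addrC addrAC.
Qed.

Lemma det_mx22 (A : 'M[C]_2) : \det A = A 0 0 * A 1 1 - A 0 1 * A 1 0.
Proof.
rewrite (expand_det_row _ 0) !big_ord_recl big_ord0 addr0 /cofactor !det_mx11
  !mxE.
have -> : lift ord0 ord0 = 1 :> 'I_2 by apply: val_inj.
have -> : lift (1 : 'I_2) 0 = 0 by apply: val_inj.
have -> : ord0 = 0 :> 'I_2 by [].
by rewrite /= expr0 expr1; ring.
Qed.

Lemma spinflip_mxE phi : (phi^T *m spinflip_mx *m phi) 0 0 =
  2 * \det (coef_mx phi).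
Proof.
have dE k l : (phi^T *m delta_mx k l *m phi) 0 0 = phi k 0 * phi l 0.
  rewrite mxE (bigD1 l) //= big1 => [|j jl].
    rewrite addr0 mxE (bigD1 k) //= big1 => [|j jk].
      by rewrite !mxE !eqxx mulr1 addr0.
    by rewrite !mxE (negPf jk) mulr0.
  rewrite mxE big1 ?mul0r // => k' _.
  by rewrite !mxE (negPf jl) andbF mulr0.
have addE (A B : 'M[C]_1) : (A + B) 0 0 = A 0 0 + B 0 0 by rewrite mxE.
have oppE (A : 'M[C]_1) : (- A) 0 0 = - A 0 0 by rewrite mxE.
have BE (A B B' D : 'M[C]_(2 * 2)) : (phi^T *m (A + B - B' - D) *m phi) 0 0 =
    (phi^T *m A *m phi) 0 0 + (phi^T *m B *m phi) 0 0
    - (phi^T *m B' *m phi) 0 0 - (phi^T *m D *m phi) 0 0.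
  by rewrite !mulmxBr mulmxDr !mulmxBl mulmxDl !(addE, oppE).
rewrite BE !dE.
by rewrite det_mx22 !mxE; ring.
Qed.

Lemma reduced_stateE phi : reduced_state phi = coef_mx phi *m (coef_mx phi) ^t*.
Proof.
apply/matrixP => i k; rewrite !mxE; apply: eq_bigr => j _.
by rewrite !mxE big_ord1 !mxE.
Qed.

Lemma tr_reduced_state phi : pure_state phi -> \tr (reduced_state phi) = 1.
Proof.
move=> hphi; have <- : (phi ^t* *m phi) 0 0 = 1.
  by rewrite (hphi : phi ^t* *m phi = 1%:M) mxE eqxx.
rewrite reduced_stateE /mxtrace [RHS]mxE (reindex _ (curry_mxvec_bij _ _)) /=.
under eq_bigr do rewrite mxE.
by rewrite pair_bigA; apply: eq_bigr => -[i j] _ /=; rewrite !mxE mulrC.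
Qed.

Lemma tr_sqr_mx22 (A : 'M[C]_2) : \tr A ^+ 2 - \tr (A *m A) = 2 * \det A.
Proof.
rewrite det_mx22 /mxtrace !big_ord_recl !big_ord0 !mxE !big_ord_recl !big_ord0.
rewrite !addr0; have -> : lift ord0 ord0 = 1 :> 'I_2 by apply: val_inj.
by ring.
Qed.

(** A 2 by 2 matrix A of trace 1 satisfies 1 - tr A^2 = 2 det A, and the determinant of the reduced
    state is the squared modulus of that of [coef_mx phi]. *)
Lemma linear_entropyE phi : pure_state phi -> exists r : R,
  [/\ 0 <= r, `|(phi^T *m spinflip_mx *m phi) 0 0| = r%:C
    & 2 * (1 - complex.Re (\tr (reduced_state phi *m reduced_state phi))) =
      r ^+ 2].
Proof.
move=> hphi; rewrite spinflip_mxE normrM normr_nat.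
have := tr_sqr_mx22 (reduced_state phi); rewrite tr_reduced_state // expr1n.
rewrite {3}reduced_stateE det_mulmx det_map_mx det_tr -normCK => h.
have [r rE] : exists r : R, `|\det (coef_mx phi)| = r%:C.
  by rewrite normc_def; eexists.
have r0 : 0 <= r by rewrite -ler0c -rE.
exists (2 * r); split; [by rewrite mulr_ge0 |
  by rewrite rE rmorphM /= rmorph_nat |].
move: h; rewrite rE; case: (\tr _) => a b [] /= ha _; move: ha.
by rewrite !(mulr0, mul0r, subr0, addr0) => ->; ring.
Qed.

Lemma pure_concurrenceE phi : pure_state phi ->
  (pure_concurrence phi)%:C = `|(phi^T *m spinflip_mx *m phi) 0 0|.
Proof.
move=> /linear_entropyE [r [r0 -> rE]].
by rewrite /pure_concurrence rE sqrtr_sqr ger0_norm.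
Qed.

Lemma reduced_state_herm phi : reduced_state phi \is hermsymmx.
Proof.
apply/is_hermitianmxP; rewrite expr0 scale1r reduced_stateE.
by rewrite adjM trmxCK.
Qed.

Lemma pure_Gconcurrence_spectrum omega phi : pure_state phi ->
  exists x : R, exists y : R, [/\ x + y = 1,
    complex.Re (\tr (reduced_state phi *m reduced_state phi)) = x ^+ 2 + y ^+ 2
    & pure_Gconcurrence omega phi = (x `^ omega + y `^ omega - 1) `^ omega].
Proof.
move=> hphi; have herm := reduced_state_herm phi.
have := hermitian_spectral_diag_real herm => /mxOverP Dr.
have := tr_reduced_state hphi.
have /orthomx_spectralP := hermitian_normalmx herm.
rewrite /pure_Gconcurrence /mxpowR.
set A := reduced_state phi; set U := spectralmx A;
  set D := spectral_diag A in Dr *.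
have hU : U \in unitmx := spectral_unit A.
have trE (d : 'rV[C]_2) : \tr (invmx U *m diag_mx d *m U) = d 0 0 + d 0 1.
  rewrite mxtrace_mulC mulmxA mulmxV // mul1mx mxtrace_diag !big_ord_recl
    big_ord0 addr0.
  by congr (_ + d _ _); apply: val_inj.
move=> AE; have := congr1 mxtrace AE; rewrite trE => -> tr1.
have [x xE] := complex_realP _ (Dr 0 0);
  have [y yE] := complex_realP _ (Dr 0 1).
exists x, y; split.
- by apply: (@complexI R); rewrite rmorphD rmorph1 /= -xE -yE.
- have -> : A *m A = invmx U *m diag_mx (\row_j (D 0 j * D 0 j)) *m U.
    rewrite -mulmx_diag; transitivity (invmx U *m diag_mx D *m U *m (invmx U *m
      diag_mx D *m U)).
      by rewrite -AE.
    by rewrite !mulmxA mulmxK.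
  by rewrite trE !mxE xE yE -!rmorphM -rmorphD /= !expr2.
- by rewrite trE !mxE xE yE /= .
Qed.

(** For eigenvalues with x + y = 1 the squared concurrence is 4 x y = 1 - (x - y)^2, so the bases in
    [h_fun] are x and y, in an order that depends on the sign of x - y. *)
Lemma pure_GconcurrenceE omega phi : pure_state phi ->
  0 <= pure_concurrence phi <= 1 /\
  pure_Gconcurrence omega phi = h_fun omega (pure_concurrence phi).
Proof.
move=> hphi; have [x [y [xy sq ->]]] := pure_Gconcurrence_spectrum omega hphi.
have c0 : 0 <= pure_concurrence phi := sqrtr_ge0 _.
have pos : 0 <= 2 * (1 - (x ^+ 2 + y ^+ 2)).
  by have [r [_ _]] := linear_entropyE hphi; rewrite sq => ->; exact: sqr_ge0.
have c2 : pure_concurrence phi ^+ 2 = 1 - (x - y) ^+ 2.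
  rewrite /pure_concurrence sq sqr_sqrtr //.
  by rewrite (_ : y = 1 - x); [ring | rewrite -xy; ring].
split.
  rewrite c0 -(@expr_le1 _ 2) // c2 gerBl sqr_ge0 //.
rewrite /h_fun c2 opprB addrCA subrr addr0 sqrtr_sqr.
have h0 : (1 + (x - y)) / 2 = x by lra.
have h1 : (1 - (x - y)) / 2 = y by lra.
have [yx|yx] := leP y x.
  have -> : `|x - y| = x - y by rewrite ger0_norm // subr_ge0.
  by rewrite h0 h1.
have -> : `|x - y| = - (x - y) by rewrite ltr0_norm // subr_lt0.
by rewrite opprK h0 h1 [x `^ _ + _]addrC.
Qed.

End TwoQubits.

(** * Optimal decompositions of two-qubit states *)

Section OptimalRoof.
Context {R : realType}.
Local Notation C := R[i].

Lemma minimumE (S : set R) x : S x -> lbound S x -> minimum S = x.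
Proof.
move=> Sx lx; apply: xget_unique; first by split.
by move=> y [Sy ly]; apply/le_anti; rewrite ly //= lx.
Qed.

Lemma diag_congr_mx n k (A : 'M[C]_(n, k)) (S : 'M[C]_n) i :
  (A^T *m S *m A) i i = ((col i A)^T *m S *m col i A) 0 0.
Proof. by rewrite tr_col -row_mul !mxE; apply: eq_bigr => j _;
  rewrite !mxE. Qed.

Lemma diag_gram_mx n k (A : 'M[C]_(n, k)) i :
  (A ^t* *m A) i i = ((col i A) ^t* *m col i A) 0 0.
Proof. by rewrite !mxE; apply: eq_bigr => j _; rewrite !mxE. Qed.

Lemma mul_adj_sum_projector n k (A : 'M[C]_(n, k)) :
  A *m A ^t* = \sum_i projector (col i A).
Proof.
apply/matrixP => a b; rewrite summxE mxE; apply: eq_bigr => i _.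
by rewrite !mxE big_ord1 !mxE.
Qed.

Lemma projectorZ n (x : R) (v : 'cV[C]_n) :
  projector (x%:C *: v) = (x ^+ 2)%:C *: projector v.
Proof.
rewrite /projector; apply/matrixP => a b; rewrite !mxE !big_ord1 !mxE.
by rewrite rmorphM /= [Num.conj x%:C]conj_real rmorphXn /=; ring.
Qed.

Lemma qformZ n (S : 'M[C]_n) (x : C) (v : 'cV[C]_n) :
  ((x *: v)^T *m S *m (x *: v)) 0 0 = x ^+ 2 * (v^T *m S *m v) 0 0.
Proof.
have -> : (x *: v)^T = x *: v^T by rewrite linearZ.
by rewrite -scalemxAr -!scalemxAl scalerA mxE expr2.
Qed.

Lemma optimal_roof (rho : 'M[C]_(2 * 2)) : density_matrix rho ->
  exists c : R, [/\ 0 <= c <= 1,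
    forall k (p : 'I_k -> R) phi, pure_decomposition rho p phi ->
      c <= \sum_i p i * pure_concurrence (phi i)
    & exists p : 'I_4 -> R, exists phi, pure_decomposition rho p phi /\
      forall i, p i = 0 \/ pure_concurrence (phi i) = c].
Proof.
move=> [herm psd trrho].
have [V [L [l [VV l0 VS lP VLW]]]] :=
  takagi_factor (conj herm psd) (@tr_spinflip_mx R).
pose lr j := complex.Re (l 0 j).
have lE j : l 0 j = (lr j)%:C by rewrite /lr RRe_real // ger0_real.
have lE' : l = \row_j (lr j)%:C by apply/rowP => j; rewrite mxE lE.
have lr0 j : 0 <= lr j by rewrite -ler0c -lE.
have [c [W [c0 cE WW qW]]] : exists c : R, exists W : 'M[C]_(2 * 2, 4),
    [/\ 0 <= c, c = 0 \/ exists j0, c = lr j0 *+ 2 - \sum_j lr j, W *m W ^t* =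
      rho
      & forall i, `|(W^T *m spinflip_mx *m W) i i| = c%:C * (W ^t* *m W) i i].
  by rewrite lE' in VS; exact: (optimal_decomposition trrho VV lr0 VS).
have lower k (p : 'I_k -> R) phi : pure_decomposition rho p phi ->
    c <= \sum_i p i * pure_concurrence (phi i).
  move=> [p0 p1 pure rhoE].
  have pc0 : 0 <= \sum_i p i * pure_concurrence (phi i).
    by apply: sumr_ge0 => i _; rewrite mulr_ge0 // sqrtr_ge0.
  case: cE => [->//|[j0 ->]].
  (* The weights are absorbed into the columns, so that [preconcurrence_lb] applies. *)
  pose X : 'M[C]_(2 * 2, k) := \matrix_(a, i) ((Num.sqrt (p i))%:C * phi i a 0).
  have colX i : col i X = (Num.sqrt (p i))%:C *: phi i.
    by apply/colP => a; rewrite !mxE.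
  have XX : X *m X ^t* = rho.
    rewrite mul_adj_sum_projector rhoE; apply: eq_bigr => i _.
    by rewrite colX projectorZ sqr_sqrtr.
  have := preconcurrence_lb j0 l0 VS lP XX (VLW _ _ XX).
  rewrite (eq_bigr (fun i => (p i * pure_concurrence (phi i))%:C)) => [|i _];
    last first.
    rewrite diag_congr_mx colX qformZ normrM normrX -pure_concurrenceE //.
    by rewrite normc_def /= expr0n addr0 sqrtr_sqr ger0_norm ?sqrtr_ge0 //
      -rmorphXn /= sqr_sqrtr // -rmorphM.
  rewrite -rmorph_sum /= (eq_bigr (fun j =>
    (lr j)%:C)) // -rmorph_sum lE -rmorphMn -rmorphB /=.
  by rewrite lecR.
pose p i := complex.Re ((W ^t* *m W) i i).
have g0 i : 0 <= (W ^t* *m W) i i.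
  by rewrite mxE sumr_ge0 // => a _; rewrite !mxE mulrC mul_conjC_ge0.
have pE i : (W ^t* *m W) i i = (p i)%:C by rewrite /p RRe_real // ger0_real.
have p0 i : 0 <= p i by rewrite -ler0c -pE.
have colW0 i : p i = 0 -> col i W = 0.
  move=> pi0; apply/colP => a; rewrite !mxE.
  have := pE i; rewrite pi0 mxE => /eqP;
    rewrite psumr_eq0 => [/allP/(_ a (mem_index_enum _))|b _].
    by rewrite /= !mxE mulrC mul_conjC_eq0 => /eqP.
  by rewrite !mxE mulrC mul_conjC_ge0.
(* A zero column cannot be normalized; a basis vector of weight 0 takes its place. *)
pose phi i : 'cV[C]_(2 * 2) :=
  if p i == 0 then delta_mx 0 0 else ((Num.sqrt (p i))^-1)%:C *: col i W.
have sp i : p i != 0 -> (Num.sqrt (p i))^-1 ^+ 2 = (p i)^-1.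
  by rewrite exprVn sqr_sqrtr.
have pure i : pure_state (phi i).
  rewrite /pure_state /phi; have [pi0|pi0] := eqVneq (p i) 0.
    rewrite trmx_delta map_delta_mx mul_delta_mx; apply/matrixP => a b.
    by rewrite !ord1 !mxE eqxx.
  apply/matrixP => a b; rewrite !ord1 [RHS]mxE eqxx.
  have -> (x : R) (v : 'cV[C]_(2 * 2)) :
      ((x%:C *: v) ^t* *m (x%:C *: v)) 0 0 = (x ^+ 2)%:C * (v ^t* *m v) 0 0.
    rewrite !mxE mulr_sumr; apply: eq_bigr => j _; rewrite !mxE.
    by rewrite rmorphM /= [Num.conj x%:C]conj_real rmorphXn /=; ring.
  by rewrite -diag_gram_mx pE sp // -rmorphM /= mulVf.
have dec : pure_decomposition rho p phi.
  split=> //.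
  - have : complex.Re (\tr (W ^t* *m W)) = 1 by rewrite mxtrace_mulC WW trrho.
    by rewrite /mxtrace raddf_sum.
  - rewrite -WW mul_adj_sum_projector; apply: eq_bigr => i _.
    rewrite /phi; have [pi0|pi0] := eqVneq (p i) 0.
      by rewrite pi0 scale0r colW0 // /projector mul0mx.
    by rewrite projectorZ sp // scalerA -rmorphM /= mulfV // scale1r.
have opt i : p i = 0 \/ pure_concurrence (phi i) = c.
  have [pi0|pi0] := eqVneq (p i) 0; [by left | right].
  apply: (@complexI R); rewrite pure_concurrenceE // /phi (negPf pi0) qformZ.
  rewrite -diag_congr_mx normrM qW pE -rmorphXn /= sp //.
  rewrite normc_def /= expr0n addr0 sqrtr_sqr ger0_norm ?invr_ge0 //
    -!rmorphM /=.
  by rewrite mulrCA mulVf // mulr1.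
exists c; split=> //; last by exists p, phi.
rewrite c0 /=; apply: le_trans (lower _ _ _ dec) _.
have [_ p1 _ _] := dec; rewrite -[leRHS]p1; apply: ler_sum => i _.
by rewrite ler_piMr //; have [/andP[]] := pure_GconcurrenceE 1 (pure i).
Qed.

End OptimalRoof.

Theorem theorem1 (R : realType) (omega : R)
    (homega_ge : (85 * 1000 + 798) / 10 ^+ 5 <= omega) (homega_le : omega <= 1)
    (rho : 'M[R[i]]_(2 * 2)) (hrho : density_matrix rho) :
  @Gconcurrence R 2 2 omega rho = h_fun omega (@concurrence R 2 2 rho).
Proof.
have [c [c01 lower [p [phi [dec opt]]]]] := optimal_roof hrho.
have [p0 p1 pure _] := dec.
(* Members of weight 0 may have another concurrence but contribute nothing. *)
have avg (f : R -> R) : \sum_i p i * f (pure_concurrence (phi i)) = f c.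
  rewrite -[RHS]mul1r -p1 mulr_suml; apply: eq_bigr => i _.
  by have [->|->] := opt i; rewrite ?mul0r.
have -> : concurrence rho = c.
  apply: minimumE; first by exists 4, p, phi; split=> //; rewrite (avg id).
  by move=> _ [k [q [psi [hdec ->]]]]; exact: lower.
have GE k (q : 'I_k -> R) psi : pure_decomposition rho q psi ->
    \sum_i q i * pure_Gconcurrence omega (psi i) =
    \sum_i q i * h_fun omega (pure_concurrence (psi i)).
  move=> [_ _ qpure _]; apply: eq_bigr => i _; congr (_ * _).
  by have [] := pure_GconcurrenceE omega (qpure i).
apply: minimumE.
  by exists 4, p, phi; split=> //; rewrite (GE _ _ _ dec) (avg (h_fun omega)).
move=> _ [k [q [psi [hdec ->]]]]; rewrite GE //; have [q0 q1 qpure _] := hdec.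
have homega : 1 - (14 * 1000 + 202) / 10 ^+ 5 <= omega by lra.
apply: (h_fun_jensen erefl homega) => //; last exact: lower.
by move=> i; have [] := pure_GconcurrenceE omega (qpure i).
Qed.
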